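(* $\widehat{\mathcal{LG}}=\widehat{\mathcal{DC}}$, i.e., a graph limit is a line graph limit if and only if it is a disjoint clique graph limit. Hence, the set $\widehat{\mathcal{LG}}$ of line graph limits is the set $\{\Gamma^{\mathcal M}_{\mathbf s}:\mathbf s\in\mathcal M\}$.
   Context: All graphs are finite and simple (with at least one vertex). $\mathcal U$ is the set of all unlabelled graphs (isomorphism classes of graphs), and $|G|$ is the number of vertices of $G$. For graphs $F,G$, $t(F,G)$ is the probability that a uniformly random map $V(F)\to V(G)$ is a graph homomorphism. The space $\overline{\mathcal U}$: embed $\mathcal U$ in $[0,1]^{\mathcal U}\times[0,1]$ by $G\mapsto((t(F,G))_{F\in\mathcal U},1/|G|)$ and let $\overline{\mathcal U}$ be the closure of the image; it is a compact metrizable space in which $\mathcal U$ is a countable, discrete, dense, open subset. The elements of $\widehat{\mathcal U}:=\overline{\mathcal U}\setminus\mathcal U$ are called graph limits. For each fixed $F$, $t(F,\cdot)$ extends by continuity to $\overline{\mathcal U}$, and a graph limit $\Gamma$ is determined by the numbers $t(F,\Gamma)$. For $\mathcal P\subseteq\mathcal U$, $\overline{\mathcal P}$ is its closure in $\overline{\mathcal U}$ and $\widehat{\mathcal P}:=\overline{\mathcal P}\cap\widehat{\mathcal U}$, the set of graph limits of sequences of graphs in $\mathcal P$. A graphon is a symmetric measurable function $W:\mathcal S^2\to[0,1]$ for some probability space $(\mathcal S,\mu)$; $t(F,W):=\int_{\mathcal S^{|F|}}\prod_{ij\in E(F)}W(x_i,x_j)\,d\mu(x_1)\cdots d\mu(x_{|F|})$.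 Each graphon $W$ represents a unique graph limit $[W]$, characterized by $t(F,[W])=t(F,W)$ for every graph $F$. The line graph $L(G)$ of a graph $G$ has as vertices the edges of $G$, two edges being adjacent in $L(G)$ if they have a common endpoint in $G$. $\mathcal{LG}$ is the class of line graphs, and line graph limits are the elements of $\widehat{\mathcal{LG}}$. $\mathcal{DC}$ is the class of disjoint clique graphs, i.e. graphs that are disjoint unions of cliques $K_m$, $m\ge1$; disjoint clique graph limits are the elements of $\widehat{\mathcal{DC}}$. A mass-partition is a sequence $\mathbf s=(s_i)_{i=1}^\infty$ of real numbers with $s_1\ge s_2\ge\cdots\ge0$ and $\sum_{i=1}^\infty s_i\le1$; $\mathcal M$ is the set of all mass-partitions. For $\mathbf s\in\mathcal M$, take disjoint measurable subsets $(A_i)_{i=1}^\infty$ of a probability space $(\mathcal S,\mu)$ with $\mu(A_i)=s_i$ (for example consecutive intervals of length $s_i$ in $[0,1]$ with Lebesgue measure), let $W^{\mathcal M}_{\mathbf s}:=\sum_{i=1}^\infty\mathbf 1_{A_i\times A_i}$, and let $\Gamma^{\mathcal M}_{\mathbf s}:=[W^{\mathcal M}_{\mathbf s}]$ (which does not depend on the choices). *)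

(* Defs.v *)
From HB Require Import structures.
From mathcomp Require Import all_boot all_order all_algebra.
From mathcomp Require Import generic_quotient.
From mathcomp Require Import all_classical all_reals all_analysis.
From mathcomp Require Import measurable_realfun.

Set Implicit Arguments.
Unset Strict Implicit.
Unset Printing Implicit Defensive.

Import Order.TTheory GRing.Theory Num.Theory.
Import numFieldNormedType.Exports.

Record sgraph (V : finType) := SGraph {
  adj :> rel V;
  adj_sym : symmetric adj;
  adj_irr : irreflexive adj }.

Definition iso (V W : finType) (G : sgraph V) (H : sgraph W) : Prop :=
  exists2 f : V -> W, bijective f & forall x y, H (f x) (f y) = G x y.

Lemma iso_refl (V : finType) (G : sgraph V) : iso G G.
Proof. by exists id => //; exists id. Qed.

Lemma iso_sym (V W : finType) (G : sgraph V) (H : sgraph W) :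
  iso G H -> iso H G.
Proof.
move=> [f [g fK gK] fH]; exists g; first by exists f.
by move=> x y; rewrite -fH !gK.
Qed.

Lemma iso_trans (V W X : finType)
    (G : sgraph V) (H : sgraph W) (K : sgraph X) :
  iso G H -> iso H K -> iso G K.
Proof.
move=> [f bf fH] [g bg gK]; exists (g \o f); first exact: bij_comp.
by move=> x y; rewrite /= gK fH.
Qed.

Lemma complete_sym (V : finType) : symmetric [rel x y : V | x != y].
Proof. by move=> x y /=; rewrite eq_sym. Qed.

Lemma complete_irr (V : finType) : irreflexive [rel x y : V | x != y].
Proof. by move=> x /=; rewrite eqxx. Qed.

Definition complete (V : finType) : sgraph V :=
  SGraph (@complete_sym V) (@complete_irr V).

Section DisjointUnion.
Variables (I : finType) (V : I -> finType) (G : forall i, sgraph (V i)).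

(* [tagged_as u v] is the vertex component of [v], transported to the part
   of [u] when both lie in the same part. *)
Definition dunion_adj : rel {i : I & V i} :=
  [rel u v | (tag u == tag v) && G (tag u) (tagged u) (tagged_as u v)].

Lemma dunion_sym : symmetric dunion_adj.
Proof.
move=> [i x] [j y]; rewrite /dunion_adj /= [j == i]eq_sym.
by case: eqP => //= eij; subst j; rewrite !tagged_asE adj_sym.
Qed.

Lemma dunion_irr : irreflexive dunion_adj.
Proof. by move=> [i x]; rewrite /dunion_adj /= tagged_asE adj_irr andbF. Qed.

Definition dunion : sgraph {i : I & V i} := SGraph dunion_sym dunion_irr.

End DisjointUnion.

Section LineGraph.
Variables (V : finType) (G : sgraph V).

Definition is_edge (e : {set V}) : bool :=
  [exists x, exists y, G x y && (e == [set x; y])].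

Definition edge := {e : {set V} | is_edge e}.

Definition line_adj : rel edge :=
  [rel e f : edge | (e != f) && ~~ [disjoint val e & val f]].

Lemma line_sym : symmetric line_adj.
Proof. by move=> e f; rewrite /line_adj /= eq_sym disjoint_sym. Qed.

Lemma line_irr : irreflexive line_adj.
Proof. by move=> e; rewrite /line_adj /= eqxx. Qed.

Definition line_graph : sgraph edge := SGraph line_sym line_irr.

End LineGraph.

(* Graphs with at least one vertex, on the vertex set {0, ..., order_pred}. *)
Record graph := Graph {
  order_pred : nat;
  graph_of :> sgraph 'I_order_pred.+1 }.

HB.instance Definition _ := gen_eqMixin graph.
HB.instance Definition _ := gen_choiceMixin graph.

Definition nverts (G : graph) : nat := (order_pred G).+1.

Definition isob : rel graph := [rel G H : graph | `[< iso G H >]].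

Lemma isob_equiv : equiv_class_of isob.
Proof.
split=> [G|G H|H G K].
- exact/asboolP/iso_refl.
- by apply/asboolP/asboolP; exact: iso_sym.
- by move=> /asboolP GH /asboolP HK; apply/asboolP; exact: iso_trans GH HK.
Qed.

Canonical isob_rel := EquivRelPack isob_equiv.

Definition ugraph := {eq_quot isob_rel}%qT.
HB.instance Definition _ := Choice.on ugraph.

Definition is_hom (V W : finType) (F : sgraph V) (G : sgraph W)
    (f : {ffun V -> W}) : bool :=
  [forall x, forall y, F x y ==> G (f x) (f y)].

Local Open Scope classical_set_scope.
Local Open Scope ring_scope.

(* Unlabelled graphs are handled through representatives: all notions below
   are invariant under isomorphism. *)
Definition LG : set ugraph :=
  [set u | exists G : graph, iso (repr u : graph) (line_graph G)].

Definition DC : set ugraph :=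
  [set u | exists (k : nat) (m : 'I_k -> nat), (forall i, (1 <= m i)%N) /\
     iso (repr u : graph) (dunion (fun i : 'I_k => complete 'I_(m i)))].

Section Limits.
Variable R : realType.

Definition hom_density (F G : ugraph) : R :=
  #|[pred f | is_hom (repr F : graph) (repr G : graph) f]|%:R
  / #|{ffun 'I_(nverts (repr F)) -> 'I_(nverts (repr G))}|%:R.

(* R^U x R; the image of [embed] lies in its closed subspace
   [0,1]^U x [0,1], so closures may be taken here. *)
Definition ambient := ({ptws ugraph -> R} * R)%type.

Definition embed (G : ugraph) : ambient :=
  (fun F => hom_density F G, ((nverts (repr G))%:R)^-1).

Definition Ubar : set ambient := closure (range embed).

Definition Uhat : set ambient := Ubar `\` range embed.

(* The continuous extension of t(F, -) to Ubar is a coordinate projection. *)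
Definition lim_density (F : ugraph) (Gamma : ambient) : R := Gamma.1 F.

Definition hat (P : set ugraph) : set ambient :=
  closure (embed @` P) `&` Uhat.

Record graphon d (S : measurableType d) := Graphon {
  graphon_fun :> S * S -> R;
  graphon_meas : measurable_fun setT graphon_fun;
  graphon_sym : forall x y, graphon_fun (x, y) = graphon_fun (y, x);
  graphon_ge0 : forall z, 0 <= graphon_fun z;
  graphon_le1 : forall z, graphon_fun z <= 1 }.

Section GraphonDensity.
Context d (S : measurableType d) (mu : probability S R).

(* The integral of f over S^n with respect to dmu(x_1) ... dmu(x_n). *)
Fixpoint iter_integral (n : nat) : (n.-tuple S -> \bar R) -> \bar R :=
  match n with
  | 0 => fun f => f [tuple]
  | n'.+1 => fun f =>
      (\int[mu]_x iter_integral (fun t : n'.-tuple S => f [tuple of x :: t]))%E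
  end.

(* Each edge {i, j} of F contributes one factor, the one with i < j. *)
Definition graphon_density (F : ugraph) (W : graphon S) : R :=
  fine (iter_integral (fun x : (nverts (repr F)).-tuple S =>
    (\prod_(e : 'I_(nverts (repr F)) * 'I_(nverts (repr F))
             | (e.1 < e.2)%N && (repr F : graph) e.1 e.2)
       W (tnth x e.1, tnth x e.2))%:E)).

Definition represents (W : graphon S) (Gamma : ambient) : Prop :=
  Uhat Gamma /\ forall F, lim_density F Gamma = graphon_density F W.

(* [W]: the unique graph limit represented by W. *)
Definition graphon_limit (W : graphon S) : ambient :=
  get [set Gamma | represents W Gamma].

End GraphonDensity.

Record mass_partition := MassPartition {
  mp_seq :> nat -> R;
  mp_noninc : nonincreasing_seq mp_seq;
  mp_ge0 : forall i, 0 <= mp_seq i;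
  mp_sum_le1 : (\sum_(i <oo) (mp_seq i)%:E <= 1)%E }.

Record mp_choice (s : mass_partition) := MPChoice {
  mpc_display : measure_display;
  mpc_space : measurableType mpc_display;
  mpc_mu : probability mpc_space R;
  mpc_set : nat -> set mpc_space;
  mpc_meas : forall i, measurable (mpc_set i);
  mpc_disj : trivIset setT mpc_set;
  mpc_mass : forall i, mpc_mu (mpc_set i) = (s i)%:E }.

Arguments mpc_mu {s} m.
Arguments mpc_set {s} m _.

Section MassPartitionGraphon.
Variables (s : mass_partition) (c : mp_choice s).

Definition mp_fun (z : mpc_space c * mpc_space c) : R :=
  limn (fun n => \sum_(0 <= i < n) (\1_(mpc_set c i `*` mpc_set c i) z : R)).

Lemma mp_funE : mp_fun = \1_(\bigcup_i (mpc_set c i `*` mpc_set c i)).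
Proof.
apply/funext => z; rewrite /mp_fun.
have [[i _ zi]|zN] := pselect ((\bigcup_i (mpc_set c i `*` mpc_set c i)) z).
  rewrite [RHS]indicE mem_set; last by exists i.
  apply: cvg_lim => //; apply: cvg_near_cst.
  exists i.+1 => // n /= ilen.
  rewrite (bigD1_seq i) ?mem_index_iota ?iota_uniq //= indicE mem_set//.
  rewrite big1 ?addr0 // => j ji; rewrite indicE memNset // => zj.
  have /trivIsetP/(_ j i Logic.I Logic.I ji) := @mpc_disj _ c.
  by move=> /seteqP[+ _] => /(_ z.1); apply; split; [case: zj|case: zi].
rewrite [RHS]indicE memNset//; apply: cvg_lim => //; apply: cvg_near_cst.
near=> n; rewrite big1 // => i _; rewrite indicE memNset // => zi.
by apply: zN; exists i.
Unshelve. all: by end_near. Qed.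

Lemma mp_fun_meas : measurable_fun setT mp_fun.
Proof.
rewrite mp_funE; apply: measurable_indic; apply: bigcup_measurable => i _.
by apply: measurableX; exact: mpc_meas.
Qed.

Lemma mp_fun_sym x y : mp_fun (x, y) = mp_fun (y, x).
Proof.
rewrite mp_funE !indicE; congr (nat_of_bool _)%:R.
by apply/idP/idP; rewrite !inE => -[i _ [? ?]]; exists i.
Qed.

Lemma mp_fun_ge0 z : 0 <= mp_fun z.
Proof. by rewrite mp_funE indicE. Qed.

Lemma mp_fun_le1 z : mp_fun z <= 1.
Proof. by rewrite mp_funE indicE lern1 leq_b1. Qed.

Definition mp_graphon : graphon (mpc_space c) :=
  Graphon mp_fun_meas mp_fun_sym mp_fun_ge0 mp_fun_le1.

Definition mp_limit : ambient := graphon_limit (mpc_mu c) mp_graphon.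

End MassPartitionGraphon.

(* Every mass-partition admits a choice: consecutive intervals in [0,1]. *)
Section IntervalChoice.
Variable s : mass_partition.

Let psum (n : nat) : R := \sum_(0 <= i < n) s i.

Definition interval_set (i : nat) : set (measurableTypeR R) :=
  `[psum i, psum i.+1[%classic.

Let psum_le i j : (i <= j)%N -> psum i <= psum j.
Proof.
move=> ij; rewrite /psum (@big_cat_nat _ _ _ i 0 j) //= lerDl.
by apply: sumr_ge0 => k _; exact: mp_ge0.
Qed.

Let psum_ge0 n : 0 <= psum n.
Proof. by apply: sumr_ge0 => k _; exact: mp_ge0. Qed.

Let psum_le1 n : psum n <= 1.
Proof.
rewrite -lee_fin; apply: le_trans (@mp_sum_le1 s).
rewrite /psum -sumEFin; apply: nneseries_lim_ge => k _ _.
by rewrite lee_fin mp_ge0.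
Qed.

Lemma interval_meas i : measurable (interval_set i).
Proof. exact: measurable_itv. Qed.

Lemma interval_disj : trivIset setT interval_set.
Proof.
apply: ltn_trivIset => i j ij; apply/seteqP; split => // x [] /=.
rewrite /interval_set /= !in_itv /= => /andP[_ xi] /andP[jx _].
by have := lt_le_trans xi (le_trans (psum_le ij) jx); rewrite ltxx.
Qed.

Lemma interval_mass i :
  uniform_prob (@ltr01 R) (interval_set i) = (s i)%:E.
Proof.
rewrite /uniform_prob integral_uniform_pdf setIidl; last first.
  move=> x; rewrite /interval_set /= !in_itv /= => /andP[x1 x2].
  by rewrite (le_trans (psum_ge0 i) x1) (le_trans (ltW x2) (psum_le1 _)).
rewrite (eq_integral (fun=> 1%:E)); last first.
  move=> x; rewrite inE /interval_set /= in_itv /= => /andP[x1 x2].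
  rewrite /uniform_pdf (le_trans (psum_ge0 i) x1).
  by rewrite (le_trans (ltW x2) (psum_le1 _)) subr0 invr1.
rewrite integral_cst ?mul1e; last exact: interval_meas.
rewrite /= lebesgue_measure_itv /= lte_fin.
have psumS : psum i.+1 = psum i + s i by rewrite /psum big_nat_recr.
rewrite psumS ltrDl; case: ltP => [_|si0].
  by rewrite -EFinB addrC addKr.
by congr EFin; apply/esym/eqP; rewrite eq_le si0 mp_ge0.
Qed.

Definition interval_choice : mp_choice s :=
  @MPChoice s _ (measurableTypeR R) (uniform_prob (@ltr01 R))
    interval_set interval_meas interval_disj interval_mass.

End IntervalChoice.

End Limits.

Arguments hat R P : clear implicits.
Arguments hom_density R F G : clear implicits.
Arguments embed R G : clear implicits.

(* Main.v *)
Require Import Defs.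
From mathcomp Require Import all_boot all_order all_algebra.
From mathcomp Require Import all_classical all_reals all_analysis.
Local Open Scope classical_set_scope.
Local Open Scope ring_scope.

From mathcomp Require Import measurable_realfun.
From mathcomp Require Import lra zify.

(** Disjoint clique graphs are line graphs, of forests of stars, so one
    inclusion between the two sets of limits is clear ([DC_sub_LG]).  For the
    other one, let [G] be the line graph of a graph with [n] edges, and call a
    vertex of that graph big if its degree exceeds [n / q].  The degrees sum to
    [2 * n], so there are at most [2 * q] big vertices, and a bounded number of
    edges join two of them.  Pairs of edges that meet in a small vertex number
    at most the sum of the squared degrees of the small vertices, which is at
    most [2 * n ^ 2 / q].  Apart from these exceptions, which are a proportion
    [O(1 / q)] of all pairs for large [n], two edges are adjacent in [G] exactly
    when they share a big vertex, and this relation is a disjoint union of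
    cliques ([LG_near_DC]).  Changing few pairs changes homomorphism densities
    little ([wdens_close]), so limits of line graphs are limits of disjoint
    clique graphs ([closure_approx], [hat_LG]).

    The densities in a disjoint clique graph are, up to loops, those in the
    step graphon of its clique sizes divided by its order ([DC_near_block]).
    For a mass partition [s], truncation of the step graphon after [K] blocks
    changes the density of [F] by at most [|F| ^ 2 * s K]
    ([graphon_density_block]), and [s K <= 1 / (K + 1)].  The truncated density
    is a polynomial in finitely many masses, so the density of [F] is a uniform
    limit of continuous functions of [s] for the product topology
    ([mp_point_continuous]).  Mass partitions form a compact set
    ([mp_set_compact]), hence their limit points form a closed set, and limits
    of disjoint clique graphs belong to it.  Conversely the clique sizes
    obtained by rounding approximate every mass partition ([block_graph],
    [mp_point_closure]).

    Both arguments concern limits of graphs whose orders tend to infinity.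
    That all graph limits are of this kind is [UhatP]: there are finitely many
    graphs of each order. *)

Set Implicit Arguments.
Unset Strict Implicit.
Unset Printing Implicit Defensive.

Import Order.TTheory GRing.Theory Num.Theory.
Import numFieldNormedType.Exports.

(** * The ambient space of densities *)

Lemma hausdorff_prod (T U : topologicalType) :
  hausdorff_space T -> hausdorff_space U -> hausdorff_space (T * U)%type.
Proof.
move=> hT hU [p1 p2] [q1 q2] pq; congr pair.
- apply: hT => A B pA qB.
  have [[x y] [/= Ax Bx]] := pq (fst @^-1` A) (fst @^-1` B)
    (cvg_fst pA) (cvg_fst qB).
  by exists x.
- apply: hU => A B pA qB.
  have [[x y] [/= Ax Bx]] := pq (snd @^-1` A) (snd @^-1` B)
    (cvg_snd pA) (cvg_snd qB).
  by exists y.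
Qed.

Section Ambient.
Variable R : realType.
Implicit Types (Gamma : ambient R) (F : ugraph).

Lemma ambient_hausdorff : hausdorff_space (ambient R).
Proof.
apply: hausdorff_prod; last exact: Rhausdorff.
exact: (@hausdorff_product ugraph (fun=> R : topologicalType)
  (fun=> @Rhausdorff R)).
Qed.

Lemma cvg_ambient {T : Type} (FF : set_system T) (f : T -> ambient R) Gamma :
  Filter FF ->
  (forall F, (f x).1 F @[x --> FF] --> Gamma.1 F) ->
  (f x).2 @[x --> FF] --> Gamma.2 -> f @ FF --> Gamma.
Proof.
move=> FFF f1 f2.
rewrite (_ : f = fun x => ((f x).1, (f x).2)); last first.
  by apply/funext => x; case: (f x).
rewrite (_ : nbhs Gamma = nbhs (Gamma.1, Gamma.2)); last by case: Gamma {f1 f2}.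
apply: (@cvg_pair _ _ _ FF (nbhs Gamma.1) (nbhs Gamma.2)) => //.
apply/cvg_sup => F.
move=> A [B [[C Copen <-]]] /= CG BA.
have : nbhs (Gamma.1 F) C by exact: open_nbhs_nbhs.
move=> /f1 fC; change (FF ((fun x => (f x).1) @^-1` A)).
have CA : (fun x => (f x).1 F) @^-1` C `<=` (fun x => (f x).1) @^-1` A.
  by move=> t Ct; exact: BA.
exact: (filterS CA fC).
Qed.

Lemma density_continuous F : continuous (fun x : ambient R => x.1 F).
Proof.
move=> x; apply: (@cvg_comp _ _ _ fst (fun g : {ptws ugraph -> R} => g F) _
  (nbhs x.1)); first exact: cvg_fst.
exact: (@proj_continuous ugraph (fun=> R : topologicalType) F x.1).
Qed.

(** The boxes around a point, given by finitely many density coordinates and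
    the order coordinate, are a base of its neighbourhoods; this is how the
    product topology is used in the approximation arguments. *)
Definition box Gamma (l : seq ugraph) (eps : R) : set (ambient R) :=
  [set x | (forall F, F \in l -> `|Gamma.1 F - x.1 F| < eps) /\
           `|Gamma.2 - x.2| < eps].

Lemma box_nbhs Gamma l eps : 0 < eps -> nbhs Gamma (box Gamma l eps).
Proof.
move=> e0.
have n2 : nbhs Gamma [set x : ambient R | `|Gamma.2 - x.2| < eps].
  have c2 : x.2 @[x --> Gamma] --> Gamma.2 by exact: cvg_snd.
  by move/cvgrPdist_lt : c2 => /(_ _ e0).
have n1 : nbhs Gamma
    [set x : ambient R | forall F, F \in l -> `|Gamma.1 F - x.1 F| < eps].
  elim: l => [|F l IH]; first by apply: filterE => x F; rewrite in_nil.
  have /cvgrPdist_lt/(_ _ e0) nF := @density_continuous F Gamma.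
  by apply: filterS2 nF IH => x xF xl G; rewrite inE => /orP[/eqP->|/xl].
by apply: filterS2 n1 n2 => x; split.
Qed.

(** The coordinates converge along this filter, so it contains all
    neighbourhoods; no sub-base of the product topology has to be unfolded. *)
Definition box_filter Gamma : set_system (ambient R) :=
  [set U | exists2 le : seq ugraph * R, 0 < le.2 & box Gamma le.1 le.2 `<=` U].

Lemma box_filterP Gamma : Filter (box_filter Gamma).
Proof.
split.
- by exists ([::], 1) => //=.
- move=> P Q [[l e] /= e0 lP] [[m d] /= d0 mQ].
  exists (l ++ m, Num.min e d) => /=; first by rewrite lt_min e0 d0.
  move=> x [x1 x2]; split.
  + apply: lP; split=> [F Fl|]; last by move: x2; rewrite lt_min => /andP[].
    by have := x1 F; rewrite mem_cat Fl => /(_ isT); rewrite lt_min => /andP[].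
  + apply: mQ; split=> [F Fl|]; last by move: x2; rewrite lt_min => /andP[].
    have := x1 F; rewrite mem_cat Fl orbT => /(_ isT).
    by rewrite lt_min => /andP[].
- by move=> P Q PQ [le le0 leP]; exists le => //; exact: subset_trans PQ.
Qed.

Lemma nbhs_box Gamma U : nbhs Gamma U ->
  exists l eps, 0 < eps /\ box Gamma l eps `<=` U.
Proof.
suff GG : id @ box_filter Gamma --> Gamma.
  by move=> /GG [[l e] /= e0 lU]; exists l, e.
have ? := box_filterP Gamma.
apply: cvg_ambient => [F|]; apply/cvgrPdist_lt => e e0.
- by exists ([:: F], e) => //= x [+ _]; apply; rewrite inE.
- by exists ([::], e) => //= x [].
Qed.

(** A set that approximates another one arbitrarily well has all its limits.
    Only limits of graphs whose order tends to infinity matter here, so the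
    approximation is asked for large orders only; the error may depend on the
    test graph [F] through the factor [C F], since a box involves finitely many
    test graphs. *)
Lemma closure_approx (A B : set (ambient R)) (C : ugraph -> nat) Gamma :
  (forall eps, 0 < eps -> exists2 delta : R, 0 < delta &
     forall a, A a -> `|a.2| < delta -> exists2 b, B b &
       `|a.2 - b.2| <= eps /\ forall F, `|a.1 F - b.1 F| <= (C F)%:R * eps) ->
  Gamma.2 = 0 -> closure A Gamma -> closure B Gamma.
Proof.
move=> AB G0 AG U /nbhs_box[l [e [e0 lU]]].
(* [N] exceeds every [C F] with [F] in the list, and exceeds 1 for the order
   coordinate. *)
pose N := (\sum_(F <- l) C F).+2.
have N0 : 0 < N%:R :> R by rewrite ltr0n.
have [d d0 ABd] := AB (e / N%:R) (divr_gt0 e0 N0).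
have m0 : 0 < Num.min d (e / N%:R) by rewrite lt_min d0 divr_gt0.
have [a [Aa [al]]] := AG _ (box_nbhs Gamma l m0).
rewrite G0 sub0r normrN => a2.
have [|b Bb [ab2 ab]] := ABd a Aa.
  by move: a2; rewrite lt_min => /andP[].
exists b; split=> //; apply: lU.
have small (x y z : R) (m : nat) : `|x - y| < Num.min d (e / N%:R) ->
    `|y - z| <= m%:R * (e / N%:R) -> (m < N)%N -> `|x - z| < e.
  rewrite lt_min => /andP[_ xy] yz mN; apply: le_lt_trans (ler_distD y _ _) _.
  apply: lt_le_trans (ltr_leD xy yz) _.
  rewrite -{1}[e / _]mul1r -mulrDl mulrA ler_pdivrMr // mulrC.
  by rewrite ler_pM2l // addrC natr1 ler_nat.
split.
- move=> F Fl; apply: (small _ (a.1 F) _ (C F)); [exact: al|exact: ab|].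
  by rewrite /N ltnS leqW // (big_rem F) //= leq_addr.
- by rewrite G0; apply: (small _ a.2 _ 1%N); rewrite ?sub0r ?normrN ?mul1r //.
Qed.

End Ambient.

(** * Unlabelled graphs and their representatives *)

Definition pullback_adj (V W : finType) (f : W -> V) (G : sgraph V) : rel W :=
  fun i j => G (f i) (f j).

Lemma pullback_sym (V W : finType) (f : W -> V) (G : sgraph V) :
  symmetric (pullback_adj f G).
Proof. by move=> i j; exact: adj_sym. Qed.

Lemma pullback_irr (V W : finType) (f : W -> V) (G : sgraph V) :
  irreflexive (pullback_adj f G).
Proof. by move=> i; exact: adj_irr. Qed.

Definition pullback (V W : finType) (f : W -> V) (G : sgraph V) : sgraph W :=
  SGraph (pullback_sym f G) (pullback_irr f G).

Lemma pullback_iso (V W : finType) (f : W -> V) (G : sgraph V) :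
  bijective f -> iso (pullback f G) G.
Proof. by exists f. Qed.

Lemma iso_graph (V : finType) (G : sgraph V) : (0 < #|V|)%N ->
  exists H : graph, iso H G.
Proof.
move=> V0; have eqV : #|V|.-1.+1 = #|V| by rewrite prednK.
exists (Graph
  (pullback (fun i : 'I_#|V|.-1.+1 => enum_val (cast_ord eqV i)) G)).
apply: pullback_iso.
exists (fun x => cast_ord (esym eqV) (enum_rank x)) => [i|x].
- by rewrite enum_valK cast_ordK.
- by rewrite cast_ordKV enum_rankK.
Qed.

Section Representatives.
Local Open Scope quotient_scope.

Lemma ugraph_repr (H : graph) : iso (repr (\pi_(ugraph) H) : graph) H.
Proof.
have : \pi_(ugraph) (repr (\pi_(ugraph) H)) = \pi_(ugraph) H by rewrite reprK.
by move=> /eqmodP/asboolP.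
Qed.

(** Constructions on arbitrary finite vertex types enter the space of
    unlabelled graphs through this lemma. *)
Lemma iso_ugraph (V : finType) (G : sgraph V) : (0 < #|V|)%N ->
  exists u : ugraph, iso (repr u : graph) G.
Proof.
move=> /(iso_graph G)[H HG]; exists (\pi_(ugraph) H).
exact: iso_trans (ugraph_repr H) HG.
Qed.

Lemma ugraph_inj (u v : ugraph) :
  iso (repr u : graph) (repr v : graph) -> u = v.
Proof.
move=> uv; rewrite -(reprK u) -(reprK v); apply/eqmodP.
exact/asboolP.
Qed.

End Representatives.

Lemma iso_card (V W : finType) (G : sgraph V) (H : sgraph W) :
  iso G H -> #|V| = #|W|.
Proof. by case=> f bf _; exact: bij_eq_card bf. Qed.

(** A graph of order at most [N] is determined up to isomorphism by its order
    and by its adjacency table, read on a fixed table of side [N + 1]. *)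
Lemma finite_bounded_order (N : nat) :
  finite_set [set u : ugraph | (nverts (repr u) <= N)%N].
Proof.
pose code (u : ugraph) : 'I_N.+1 * {ffun 'I_N.+1 * 'I_N.+1 -> bool} :=
  (inord (nverts (repr u)),
   [ffun z : 'I_N.+1 * 'I_N.+1 =>
     (repr u : graph) (inord z.1) (inord z.2)]).
have code_inj : {in [set u : ugraph | (nverts (repr u) <= N)%N] &,
    injective code}.
  move=> u v; rewrite !inE /= => uN vN [/(congr1 (@nat_of_ord _))].
  rewrite !inordK // => euv adj_eq; apply: ugraph_inj.
  move: adj_eq uN vN euv; rewrite /nverts.
  case: (repr u) => n G; case: (repr v) => m H /=.
  move=> /ffunP adj_eq nN _ [nm]; subst m.
  exists id => [|x y]; first by exists id.
  have xN (z : 'I_n.+1) : (z < N.+1)%N.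
    by apply: leq_trans (ltn_ord z) _; exact: leqW.
  have := adj_eq (inord x, inord y); rewrite !ffunE /=.
  by rewrite !inordK // !inord_val => ->.
by rewrite -(eq_finite_set (inj_card_eq code_inj)); exact: finite_finset.
Qed.

Section Limits.
Variable R : realType.
Implicit Types (Gamma : ambient R).

(** A point of the closure with positive order coordinate is a limit of graphs
    of bounded order; these are finitely many, so the point is one of them.
    Conversely a graph has a positive order coordinate. *)
Lemma UhatP Gamma : closure (range (embed R)) Gamma ->
  Uhat Gamma <-> Gamma.2 = 0.
Proof.
move=> clG; split=> [[_ GN]|G0]; last first.
  split=> // -[u _ uG]; move: G0; rewrite -uG /= => /eqP.
  by rewrite invr_eq0 pnatr_eq0.
apply: contrapT => /eqP G0; apply: GN.
(* Graphs of order above [N] have an order coordinate less than half of that of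
   [Gamma]. *)
pose N := Num.Def.archi_bound (`|Gamma.2|^-1 *+ 2).
pose fin := embed R @` [set u : ugraph | (nverts (repr u) <= N)%N].
have fin_closed : closed fin.
  have acc : accessible_space (ambient R).
    exact: hausdorff_accessible (@ambient_hausdorff R).
  move/accessible_finite_set_closed : acc; apply.
  exact/finite_image/finite_bounded_order.
have GU : nbhs Gamma [set x : ambient R | `|Gamma.2 - x.2| < `|Gamma.2| / 2].
  have e0 : 0 < `|Gamma.2| / 2 by rewrite divr_gt0 ?normr_gt0.
  by apply: filterS (box_nbhs Gamma [::] e0) => x [].
suff [u _ uG] : fin Gamma by exists u.
apply: fin_closed => U GnU.
have [_ [[u _ <-] [Uu /= near_u]]] := clG _ (filterI GnU GU).
exists (embed R u); split=> //; exists u => //=.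
rewrite leqNgt; apply/negP => Nu.
have h : `|Gamma.2|^-1 *+ 2 < (nverts (repr u))%:R.
  apply: lt_trans (archi_boundP _) _; first by rewrite mulrn_wge0 // invr_ge0.
  by rewrite ltr_nat.
have p0 : 0 < `|Gamma.2| by rewrite normr_gt0.
have h' : (nverts (repr u))%:R^-1 < `|Gamma.2| / 2.
  rewrite -[ltRHS]invrK ltf_pV2 ?posrE ?ltr0n ?invr_gt0 ?divr_gt0 //.
  by rewrite invfM invrK mulr_natr.
have := ler_distD (nverts (repr u))%:R^-1 Gamma.2 0.
rewrite !subr0 normfV normr_nat; lra.
Qed.

End Limits.

(** * Densities in weighted finite relations *)

Section WeightedDensity.
Variable (R : realType) (k : nat) (E : rel 'I_k).

Definition is_homb (T : Type) (A : rel T) (f : 'I_k -> T) : bool :=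
  [forall i, forall j, E i j ==> A (f i) (f j)].

Lemma is_homP (T : Type) (A : rel T) (f : 'I_k -> T) :
  reflect (forall i j, E i j -> A (f i) (f j)) (is_homb A f).
Proof.
apply: (iffP forallP) => [h i j|h i].
  by move/forallP : (h i) => /(_ j)/implyP.
by apply/forallP => j; apply/implyP; exact: h.
Qed.

Lemma eq_is_homb (T : Type) (A : rel T) (f g : 'I_k -> T) :
  f =1 g -> is_homb A f = is_homb A g.
Proof.
by move=> fg; apply: eq_forallb => i; apply: eq_forallb => j; rewrite !fg.
Qed.

(** The probability that a random map into [T], with independent values of law
    [p], respects the relation [A].  Loops in [A] are allowed, as step graphons
    have them. *)
Definition wdens (T : finType) (A : rel T) (p : T -> R) : R :=
  \sum_(f : {ffun 'I_k -> T}) (is_homb A f)%:R * \prod_v p (f v).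

Lemma eq_wdens (T : finType) (A B : rel T) (p q : T -> R) :
  A =2 B -> p =1 q -> wdens A p = wdens B q.
Proof.
move=> AB pq; apply: eq_bigr => f _; congr (_ * _); last exact: eq_bigr.
congr (nat_of_bool _)%:R; apply: eq_forallb => i; apply: eq_forallb => j.
by rewrite AB.
Qed.

Lemma sum_family (T : finType) (Q : 'I_k -> pred T) (p : T -> R) :
  \sum_(f in family Q) \prod_v p (f v) = \prod_v \sum_(x | Q v x) p x.
Proof. by rewrite bigA_distr_big_dep. Qed.

(** A relation that only depends on labels sees the random map only through
    its labels, whose law is the image of [p]. *)
Lemma wdens_relpre (T U : finType) (lam : T -> U) (A : rel U) (p : T -> R) :
  wdens (relpre lam A) p = wdens A (fun c => \sum_(x | lam x == c) p x).
Proof.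
rewrite /wdens.
rewrite (partition_big
  (fun f : {ffun 'I_k -> T} => [ffun v => lam (f v)]) xpredT) //=.
apply: eq_bigr => c _.
rewrite -sum_family mulr_sumr; apply: eq_big => [f|f /eqP fc].
  apply/eqP/familyP => [fc v|fc].
    by rewrite -fc ffunE; exact: eqxx.
  by apply/ffunP => v; rewrite ffunE; exact/eqP/(fc v).
congr (_%:R * _); congr nat_of_bool.
by apply: eq_forallb => i; apply: eq_forallb => j; rewrite /= -fc !ffunE.
Qed.

Section Probability.
Variables (T : finType) (p : T -> R).
Hypotheses (p_ge0 : forall x, 0 <= p x) (p_sum1 : \sum_x p x = 1).

Lemma prod_weight_ge0 (f : {ffun 'I_k -> T}) : 0 <= \prod_v p (f v).
Proof. by apply: prodr_ge0 => v _. Qed.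

(** Independence of two coordinates: summing out the others gives one. *)
Lemma marginal2 (i j : 'I_k) (D : rel T) : i != j ->
  \sum_(f : {ffun 'I_k -> T}) (D (f i) (f j))%:R * \prod_v p (f v) =
  \sum_x \sum_y (D x y)%:R * (p x * p y).
Proof.
move=> ij.
rewrite (partition_big (fun f : {ffun 'I_k -> T} => (f i, f j)) xpredT) //=.
rewrite pair_bigA /=; apply: eq_bigr => -[x y] _ /=.
pose Q v : pred T :=
  fun z => ((v == i) ==> (z == x)) && ((v == j) ==> (z == y)).
transitivity (\sum_(f in family Q) (D x y)%:R * \prod_v p (f v)).
  apply: eq_big => [f|f /eqP[-> ->]] //.
  apply/eqP/familyP => [[fi fj] v|fQ].
    by apply/andP; split; apply/implyP => /eqP ->; apply/eqP.
  have /andP[/implyP/(_ (eqxx i))/eqP fi _] := fQ i.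
  have /andP[_ /implyP/(_ (eqxx j))/eqP fj] := fQ j.
  by rewrite fi fj.
rewrite -mulr_sumr sum_family; congr (_ * _).
have ji : j != i by rewrite eq_sym.
rewrite (bigD1 i) //= (bigD1 j) //=.
have -> : \prod_(v | (v != i) && (v != j)) \sum_(z | Q v z) p z = 1.
  apply: big1 => v /andP[vi vj].
  by under eq_bigl do rewrite /Q (negPf vi) (negPf vj) /=.
rewrite mulr1; congr (_ * _).
  by rewrite (big_pred1 x) // => z; rewrite /Q eqxx (negPf ij) andbT.
by rewrite (big_pred1 y) // => z; rewrite /Q eqxx (negPf ji).
Qed.

(** If a random map respects one of the relations and not the other, then the
    images of some edge of [E] form a pair on which they disagree.  The union
    bound over at most [k ^ 2] edges gives the estimate. *)
Lemma wdens_close (A B : rel T) : irreflexive E ->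
  `|wdens A p - wdens B p| <=
  (k ^ 2)%:R * \sum_x \sum_y (A x y != B x y)%:R * (p x * p y).
Proof.
move=> Eirr; rewrite -sumrB.
under eq_bigr do rewrite -mulrBl.
apply: le_trans (ler_norm_sum _ _ _) _.
pose D : rel T := fun x y => A x y != B x y.
have D_ge0 : 0 <= \sum_x \sum_y (D x y)%:R * (p x * p y).
  by do 2!apply: sumr_ge0 => ? _; rewrite mulr_ge0 // mulr_ge0.
apply: (@le_trans _ _ (\sum_(f : {ffun 'I_k -> T}) \sum_i \sum_(j | E i j)
    (D (f i) (f j))%:R * \prod_v p (f v))).
  apply: ler_sum => f _.
  have -> : \sum_i \sum_(j | E i j) (D (f i) (f j))%:R * \prod_v p (f v) =
      (\sum_i \sum_(j | E i j) (D (f i) (f j))%:R) * \prod_v p (f v).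
    by rewrite mulr_suml; apply: eq_bigr => i _; rewrite mulr_suml.
  rewrite normrM (ger0_norm (prod_weight_ge0 f)).
  apply: ler_wpM2r; first exact: prod_weight_ge0.
  have sum_ge (i j : 'I_k) : E i j -> D (f i) (f j) ->
      (1 : R) <= \sum_i \sum_(j | E i j) (D (f i) (f j))%:R.
    move=> Eij Dij; rewrite (bigD1 i) //= (bigD1 j) //= Dij -addrA lerDl.
    by rewrite addr_ge0 // !sumr_ge0 // => *; rewrite ?sumr_ge0.
  have [AB|AB] := eqVneq (is_homb A f) (is_homb B f).
    by rewrite AB subrr normr0 !sumr_ge0 // => i _; rewrite sumr_ge0.
  have [i [j [Eij Dij]]] : exists i j, E i j /\ D (f i) (f j).
    apply: contrapT => noD; move/eqP : AB; apply.
    apply/is_homP/is_homP => h i j Eij; have := h i j Eij;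
      have [Dij|] := boolP (D (f i) (f j)); do ?[by case: noD; exists i, j];
      by rewrite negbK => /eqP ->.
  apply: le_trans (sum_ge i j Eij Dij).
  by case: (is_homb A f); case: (is_homb B f);
    rewrite /= ?subrr ?subr0 ?sub0r ?normrN ?normr0 ?normr1 ?ler01.
rewrite exchange_big /=.
under eq_bigr do rewrite exchange_big /=.
apply: (@le_trans _ _ (\sum_(i < k) \sum_(j < k)
    \sum_x \sum_y (D x y)%:R * (p x * p y))).
  apply: ler_sum => i _; rewrite big_mkcond; apply: ler_sum => j _.
  case: ifP => // Eij; rewrite marginal2 //.
  by apply: contraTneq Eij => ->; rewrite Eirr.
by rewrite !sumr_const !card_ord -mulrnA -[leLHS]mulr_natl mulnn.
Qed.

End Probability.
End WeightedDensity.

Section HomDensity.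
Variable R : realType.

Lemma hom_densityE (F G : ugraph) : hom_density R F G =
  wdens (repr F : graph) (repr G : graph) (fun=> (nverts (repr G))%:R^-1).
Proof.
rewrite /hom_density /wdens.
under [RHS]eq_bigr do rewrite prodr_const card_ord.
rewrite -mulr_suml card_ffun !card_ord natrX exprVn; congr (_ / _).
rewrite -sum1_card natr_sum big_mkcond; apply: eq_bigr => f _ /=.
by rewrite -[_ \in _]/(is_hom _ _ f) -[is_homb _ _ f]/(is_hom _ _ f); case: ifP.
Qed.

Lemma hom_density_iso (F u : ugraph) (V : finType) (G : sgraph V) :
  iso (repr u : graph) G ->
  hom_density R F u = wdens (repr F : graph) G (fun=> #|V|%:R^-1).
Proof.
move=> uG; have cV : nverts (repr u) = #|V| by rewrite -(iso_card uG) card_ord.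
case: uG => f [g fK gK] fG; rewrite hom_densityE cV.
rewrite (eq_wdens _ (B := relpre f G) (q := fun=> #|V|%:R^-1)) //; last first.
  by move=> x y; rewrite /= fG.
rewrite wdens_relpre; apply: eq_wdens => // c.
rewrite (big_pred1 (g c)) // => x.
by apply/eqP/eqP => [<-|->]; rewrite ?fK ?gK.
Qed.

End HomDensity.

(** * Iterated integrals of functions of labels *)

Section LabelIntegral.
Context (R : realType) d (S : measurableType d) (mu : probability S R).
Variable lab : S -> nat.
Hypothesis lab_meas : forall a, measurable (lab @^-1` [set a]).

Lemma measurable_preimage_label (B : set nat) : measurable (lab @^-1` B).
Proof.
rewrite (_ : lab @^-1` B = \bigcup_(a in B) lab @^-1` [set a]).
  exact: bigcup_measurable.
by apply/seteqP; split=> x /= => [Bx|[a Ba ->]] //; exists (lab x).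
Qed.

Lemma measurable_fun_label d' (U : measurableType d') (h : nat -> U) :
  measurable_fun setT (fun x => h (lab x)).
Proof.
move=> _ Y _; rewrite setTI.
exact: (measurable_preimage_label (h @^-1` Y)).
Qed.

Local Open Scope ereal_scope.

(** The iterated integrals of functions that only depend on countably valued
    labels of the variables.  All such functions are measurable, so the rules of
    integration hold with no side condition on the integrand. *)
Fixpoint label_integral (n : nat) : (n.-tuple nat -> \bar R) -> \bar R :=
  match n with
  | 0 => fun f => f [tuple]
  | n'.+1 => fun f =>
      \int[mu]_x
        label_integral (fun t : n'.-tuple nat => f [tuple of lab x :: t])
  end.

Lemma iter_integral_label n (f : n.-tuple nat -> \bar R) :
  iter_integral mu (fun x => f (map_tuple lab x)) = label_integral f.
Proof.
elim: n f => [|n IH] f /=; first by congr f; exact: val_inj.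
apply: eq_integral => x _; rewrite -IH; congr iter_integral.
by apply/funext => t; congr f; exact: val_inj.
Qed.

Lemma eq_label_integral n (f g : n.-tuple nat -> \bar R) :
  f =1 g -> label_integral f = label_integral g.
Proof. by move=> /funext ->. Qed.

Lemma label_integral_ge0 n (f : n.-tuple nat -> \bar R) :
  (forall t, 0 <= f t) -> 0 <= label_integral f.
Proof.
by elim: n f => [|n IH] f f0 //=; apply: integral_ge0 => x _; exact: IH.
Qed.

Lemma le_label_integral n (f g : n.-tuple nat -> \bar R) :
  (forall t, 0 <= f t) -> (forall t, f t <= g t) ->
  label_integral f <= label_integral g.
Proof.
elim: n f g => [|n IH] f g f0 fg //=; apply: ge0_le_integral => //.
- by move=> x _; exact: label_integral_ge0.
- exact: (measurable_fun_label
    (fun a => label_integral (fun t => f [tuple of a :: t]))).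
- exact: (measurable_fun_label
    (fun a => label_integral (fun t => g [tuple of a :: t]))).
- by move=> x _; exact: IH.
Qed.

Lemma label_integralD n (f g : n.-tuple nat -> \bar R) :
  (forall t, 0 <= f t) -> (forall t, 0 <= g t) ->
  label_integral (fun t => f t + g t) = label_integral f + label_integral g.
Proof.
elim: n f g => [|n IH] f g f0 g0 //=.
under eq_integral do rewrite IH //.
rewrite ge0_integralD //.
- by move=> x _; exact: label_integral_ge0.
- exact: (measurable_fun_label
    (fun a => label_integral (fun t => f [tuple of a :: t]))).
- by move=> x _; exact: label_integral_ge0.
- exact: (measurable_fun_label
    (fun a => label_integral (fun t => g [tuple of a :: t]))).
Qed.

Lemma integral_prob_cst (r : \bar R) : \int[mu]_x r = r.
Proof.
rewrite (integral_cst mu measurableT) -[RHS]mule1; congr (_ * _).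
exact: probability_setT.
Qed.

Lemma label_integral_cst n (r : \bar R) :
  label_integral (fun _ : n.-tuple nat => r) = r.
Proof.
elim: n => [|n IH] //=.
by under eq_integral do rewrite IH; rewrite integral_prob_cst.
Qed.

Lemma label_integral_sum n (I : Type) (s : seq I) (P : pred I)
    (f : I -> n.-tuple nat -> \bar R) :
  (forall i t, 0 <= f i t) ->
  label_integral (fun t => \sum_(i <- s | P i) f i t) =
  \sum_(i <- s | P i) label_integral (f i).
Proof.
move=> f0; elim: s => [|i s IH].
  rewrite big_nil -[RHS](label_integral_cst n).
  by apply: eq_label_integral => t; rewrite big_nil.
rewrite big_cons -IH; case: ifPn => Pi.
  rewrite -label_integralD //; last by move=> t; apply: sume_ge0.
  by apply: eq_label_integral => t; rewrite big_cons Pi.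
by apply: eq_label_integral => t; rewrite big_cons (negPf Pi).
Qed.

Lemma label_integral_coord n (j : 'I_n) (h : nat -> \bar R) :
  label_integral (fun t => h (tnth t j)) = \int[mu]_x h (lab x).
Proof.
elim: n j => [[] //|n IH] j /=.
case: (unliftP ord0 j) => [i ->|->].
  under eq_integral => x _.
    under eq_label_integral do rewrite tnthS.
    rewrite IH; over.
  by rewrite integral_prob_cst.
apply: eq_integral => x _.
by under eq_label_integral do rewrite tnth0; exact: label_integral_cst.
Qed.

(** Integrating out the other coordinates costs nothing, the total mass being
    one. *)
Lemma label_integral_coord2 n (i j : 'I_n) (h : nat -> nat -> \bar R) :
  (i < j)%N -> label_integral (fun t => h (tnth t i) (tnth t j)) =
  \int[mu]_x \int[mu]_y h (lab x) (lab y).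
Proof.
elim: n i j => [[] //|n IH] i j.
case: (unliftP ord0 j) => [j' ->|->] //.
case: (unliftP ord0 i) => [i' ->|->] ij /=.
  under eq_integral => x _.
    under eq_label_integral do rewrite !tnthS.
    rewrite (IH _ _ ij); over.
  by rewrite integral_prob_cst.
apply: eq_integral => x _.
under eq_label_integral do rewrite tnth0 tnthS.
exact: (label_integral_coord j' (h (lab x))).
Qed.

Section Finite.
Variables (T : finType) (kap : nat -> T).

Definition label_mass (c : T) : R := fine (mu (lab @^-1` (kap @^-1` [set c]))).

Lemma integral_finite_label (h : T -> R) : (forall c, (0 <= h c)%R) ->
  \int[mu]_x (h (kap (lab x)))%:E = (\sum_c h c * label_mass c)%R%:E.
Proof.
move=> h0; pose B c := lab @^-1` (kap @^-1` [set c]).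
have mB c : measurable (B c) by exact: measurable_preimage_label.
transitivity (\int[mu]_x \sum_(c <- index_enum T) (h c * \1_(B c) x)%:E).
  apply: eq_integral => x _; rewrite sumEFin; congr EFin.
  rewrite (bigD1 (kap (lab x))) //= indicE mem_set // mulr1 big1 ?addr0 //.
  move=> c; rewrite eq_sym => /eqP cx.
  by rewrite indicE memNset ?mulr0.
rewrite ge0_integral_sum //=; last 2 first.
- move=> c; apply/measurable_EFinP; apply: measurable_funM => //.
- by move=> c x _; rewrite lee_fin mulr_ge0.
rewrite -sumEFin; apply: eq_bigr => c _.
rewrite (integralZl_indic measurableT (fun=> B c)) //; last first.
  by move=> /(le_lt_trans (h0 c)); rewrite ltxx.
rewrite integral_indic // setIT EFinM; congr (_ * _).
exact: (esym (fineK (fin_num_measure mu (B c) (mB c)))).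
Qed.

(** The label classes form a finite partition, on whose powers the iterated
    integral is the product of the class masses. *)
Lemma label_integral_finite n (H : n.-tuple T -> R) :
  (forall t, (0 <= H t)%R) ->
  label_integral (fun t => (H (map_tuple kap t))%:E) =
  (\sum_(t : n.-tuple T) H t * \prod_v label_mass (tnth t v))%R%:E.
Proof.
have mass0 c : (0 <= label_mass c)%R by exact: fine_ge0.
elim: n H => [|n IH] H H0 /=.
  rewrite (big_pred1 [tuple]) => [|t]; last exact/esym/eqP/tuple0.
  by rewrite big_ord0 mulr1; congr (H _)%:E; exact: val_inj.
pose h (c : T) : R :=
  (\sum_(t : n.-tuple T) H [tuple of c :: t] * \prod_v label_mass (tnth t v))%R.
transitivity (\int[mu]_x (h (kap (lab x)))%:E).
  apply: eq_integral => x _.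
  rewrite -(IH (fun t => H [tuple of kap (lab x) :: t])) //.
  by apply: eq_label_integral => t; congr (H _)%:E; exact: val_inj.
rewrite integral_finite_label; last first.
  by move=> c; apply: sumr_ge0 => t _; rewrite mulr_ge0 // prodr_ge0.
congr EFin.
have -> : (\sum_c h c * label_mass c = \sum_c \sum_(t : n.-tuple T)
    H [tuple of c :: t] * \prod_v label_mass (tnth t v) * label_mass c)%R.
  by apply: eq_bigr => c _; rewrite mulr_suml.
rewrite pair_bigA /=.
rewrite [RHS](reindex (fun ct : T * n.-tuple T => [tuple of ct.1 :: ct.2])) /=.
  apply: eq_bigr => -[c t] _ /=.
  rewrite big_ord_recl tnth0 -mulrA [X in (_ * X)%R = _]mulrC.
  congr (_ * _)%R.
  by congr (_ * _)%R; apply: eq_bigr => v _; rewrite tnthS.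
exists (fun t : n.+1.-tuple T => (thead t, [tuple of behead t]))
  => [[c t]|t] _ /=.
  by rewrite theadE; congr pair; exact: val_inj.
by rewrite -tuple_eta.
Qed.

End Finite.
End LabelIntegral.

(** * Densities of the graphon of a mass partition *)

(** Label 0 stands for the part of the space outside all blocks: points with
    this label are adjacent to nothing. *)
Definition same_block : rel nat := fun a b => (a == b) && (a != 0)%N.

Section BlockDensity.
Variable R : realType.

Definition block_weight (K : nat) (s : nat -> R) (c : 'I_K.+1) : R :=
  if (c : nat) is i.+1 then s i else 1 - \sum_(i < K) s i.

(** The density of [E] in the step graphon of the first [K] blocks.  It is a
    polynomial in the masses of these blocks, hence continuous in them. *)
Definition block_density (k : nat) (E : rel 'I_k) (K : nat) (s : nat -> R) :
    R :=
  wdens E (relpre val same_block) (@block_weight K s).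

End BlockDensity.

Local Arguments mpc_set {R s} m _ _.

Section MassPartitionDensity.
Variables (R : realType) (s : mass_partition R) (c : mp_choice s).

Definition block_label (x : mpc_space c) : nat :=
  if pselect (exists i, mpc_set c i x) is left e then (projT1 (cid e)).+1
  else 0.

Lemma block_labelP i x : block_label x = i.+1 <-> mpc_set c i x.
Proof.
rewrite /block_label; case: pselect => [e|N]; last first.
  by split=> // ci; case: N; exists i.
case: (cid e) => j /= cj; split=> [[<-//]|ci].
have [-> //|ji] := eqVneq j i.
have /trivIsetP/(_ j i Logic.I Logic.I ji) := @mpc_disj _ _ c.
by move=> /seteqP[+ _] => /(_ x (conj cj ci)).
Qed.

Lemma block_label_fiberS i : block_label @^-1` [set i.+1] = mpc_set c i.
Proof. by apply/seteqP; split=> x /= /block_labelP. Qed.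

Lemma block_label_meas a : measurable (block_label @^-1` [set a]).
Proof.
case: a => [|i]; last by rewrite block_label_fiberS; exact: mpc_meas.
rewrite (_ : _ @^-1` _ = ~` \bigcup_i (mpc_set c i)).
  by apply: measurableC; apply: bigcup_measurable => i _; exact: mpc_meas.
apply/seteqP; split=> x /=.
  by move=> x0 [i _ /block_labelP]; rewrite x0.
case E : (block_label x) => [//|i] N; case: N; exists i => //.
exact/block_labelP.
Qed.

Lemma mp_fun_label (z : mpc_space c * mpc_space c) :
  mp_fun z = (same_block (block_label z.1) (block_label z.2))%:R.
Proof.
rewrite mp_funE indicE; congr (nat_of_bool _)%:R.
apply/idP/idP; rewrite inE.
  move=> [i _ [/block_labelP /= z1 /block_labelP z2]].
  by rewrite z1 z2 /same_block eqxx.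
move=> /andP[/eqP z12 z1]; exists (block_label z.1).-1 => //.
by split; apply/block_labelP; rewrite prednK ?lt0n // z12.
Qed.

(** Blocks beyond the first [K] are merged into the part outside all blocks. *)
Definition truncate_label (K a : nat) : 'I_K.+1 :=
  inord (if (a <= K)%N then a else 0).

Lemma truncate_labelE K a :
  truncate_label K a = (if (a <= K)%N then a else 0)%N :> nat.
Proof. by rewrite inordK //; case: ifP. Qed.

Lemma same_block_truncate K a b :
  same_block (truncate_label K a) (truncate_label K b) =
  same_block a b && (a <= K)%N.
Proof.
rewrite /same_block !truncate_labelE.
by do 2!case: ifP => //; lia.
Qed.

Lemma label_mass_block K (a : 'I_K.+1) :
  label_mass (mpc_mu c) block_label (truncate_label K) a = block_weight s a.
Proof.
pose mass := label_mass (mpc_mu c) block_label (truncate_label K).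
have massS i (iK : (i.+1 < K.+1)%N) : mass (Ordinal iK) = s i.
  rewrite /mass /label_mass.
  rewrite (_ : _ @^-1` _ = mpc_set c i) ?mpc_mass //.
  rewrite -block_label_fiberS; apply/seteqP; split=> x /=.
    move/(congr1 val); rewrite /= truncate_labelE; case: ifP => //.
  move=> ->; apply/val_inj; rewrite /= truncate_labelE.
  by rewrite -ltnS iK.
case: a => [[|i] iK]; last exact: massS.
have : \sum_a mass a = 1.
  have := integral_finite_label (mpc_mu c) block_label_meas (truncate_label K)
    (h := fun=> 1) (fun=> ler01).
  rewrite (integral_prob_cst (mpc_mu c)) => -[->].
  by apply: eq_bigr => a _; rewrite mul1r.
rewrite big_ord_recl /= => /(canRL (addrK _)).
under eq_bigr => i _.
  rewrite (_ : lift _ _ = Ordinal (ltn_ord (lift ord0 i))); last exact: val_inj.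
  rewrite massS; over.
move=> m0; rewrite /block_weight /= -m0 -[LHS]/(mass _).
by congr mass; exact: val_inj.
Qed.

Lemma mass_block_le K a : (K < a)%N ->
  (mpc_mu c (block_label @^-1` [set a]) <= (s K)%:E)%E.
Proof.
case: a => [//|i] Ki; rewrite block_label_fiberS mpc_mass lee_fin.
exact: mp_noninc.
Qed.

(** The product in a graphon density has one factor for each edge, indexed by
    its increasing orientation; for a graphon with values 0 and 1 it is the
    indicator of a homomorphism. *)
Lemma is_hom_prod (F : graph) (x : 'I_(nverts F) -> mpc_space c) :
  \prod_(e : 'I_(nverts F) * 'I_(nverts F) | (e.1 < e.2)%N && F e.1 e.2)
    mp_graphon c (x e.1, x e.2) =
  (is_homb F same_block (fun v => block_label (x v)))%:R :> R.
Proof.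
case: is_homP => h /=.
  by apply: big1 => -[i j] /= /andP[_ Fij]; rewrite mp_fun_label h.
have [i [j [ij Fij Nij]]] : exists i j : 'I_(nverts F), [/\ (i < j)%N, F i j &
    ~~ same_block (block_label (x i)) (block_label (x j))].
  apply: contrapT => N; apply: h => i j Fij.
  have sym a b : same_block a b = same_block b a.
    by rewrite /same_block eq_sym; case: eqP => // ->.
  apply/negPn/negP => Nij; apply: N.
  have [ij|ji|/val_inj ij] := ltngtP i j; first by exists i, j.
    by exists j, i; rewrite adj_sym sym.
  by move: Fij; rewrite ij adj_irr.
rewrite (bigD1 (i, j)) /=; last by rewrite ij.
by rewrite mp_fun_label (negPf Nij) mul0r.
Qed.

(** Truncating after [K] blocks only loses the maps that send both ends of some
    edge into one block of index at least [K].  Given the first end, the second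
    one falls into its block with probability at most [s K], as the masses
    decrease; there are at most [nverts F ^ 2] edges. *)
Lemma graphon_density_block (F : ugraph) (K : nat) :
  `|graphon_density (mpc_mu c) F (mp_graphon c)
    - block_density (repr F : graph) K s| <= (nverts (repr F) ^ 2)%:R * s K.
Proof.
set k := nverts (repr F); pose E : rel 'I_k := (repr F : graph).
pose J := @label_integral R _ _ (mpc_mu c) block_label k.
pose G (t : k.-tuple nat) : \bar R := (is_homb E same_block (tnth t))%:R%:E.
pose H (t : k.-tuple 'I_K.+1) : R :=
  (is_homb E (relpre val same_block) (tnth t))%:R.
pose HK (t : k.-tuple nat) : \bar R := (H (map_tuple (truncate_label K) t))%:E.
(* The pairs of labels that truncation makes non-adjacent. *)
pose bad (a b : nat) : R := ((a == b) && (K < a)%N)%:R.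
have Jmeas := block_label_meas.
have JG : graphon_density (mpc_mu c) F (mp_graphon c) = fine (J G).
  rewrite /graphon_density -[J G]iter_integral_label.
  congr (fine (iter_integral _ _)).
  apply/funext => x; rewrite is_hom_prod; congr (_%:R%:E); congr nat_of_bool.
  by apply: eq_is_homb => v; rewrite tnth_map.
have JHK : J HK = (block_density E K s)%:E.
  rewrite /J label_integral_finite //; congr EFin.
  rewrite (reindex (fun f : {ffun 'I_k -> 'I_K.+1} => [tuple f i | i < k])) /=.
    apply: eq_bigr => f _; congr (_ * _).
      congr (nat_of_bool _)%:R; apply: eq_is_homb => v.
      by rewrite tnth_mktuple.
    by apply: eq_bigr => v _; rewrite tnth_mktuple label_mass_block.
  exists (fun t : k.-tuple 'I_K.+1 => [ffun i => tnth t i]) => [f|t] _.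
    by apply/ffunP => i; rewrite ffunE tnth_mktuple.
  by apply: eq_from_tnth => i; rewrite tnth_mktuple ffunE.
have HKE t : HK t =
    (is_homb E (relpre (truncate_label K) (relpre val same_block))
      (tnth t))%:R%:E.
  congr (_%:R%:E); congr nat_of_bool.
  apply: eq_forallb => i; apply: eq_forallb => j.
  by rewrite !tnth_map.
have HKG t : (HK t <= G t)%E.
  rewrite HKE lee_fin ler_nat.
  have [h|] := is_homP; last by [].
  by have /is_homP -> : forall i j, E i j -> same_block (tnth t i) (tnth t j)
    by move=> i j /h /=; rewrite same_block_truncate => /andP[].
pose bads (t : k.-tuple nat) := \sum_(i < k) \sum_(j < k | (i < j)%N)
  bad (tnth t i) (tnth t j).
have bads_ge0 t : 0 <= bads t by do 2!apply: sumr_ge0 => ? _.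
have GHK t : (G t <= HK t + (bads t)%:E)%E.
  rewrite HKE -EFinD lee_fin.
  have [h|N] := is_homP _ same_block; last by rewrite addr_ge0.
  have [h'|N] := is_homP; first by rewrite lerDl.
  have [i [j [ij bad_ij]]] : exists i j : 'I_k, (i < j)%N /\
      bad (tnth t i) (tnth t j) = 1.
    apply: contrapT => NN; apply: N => i j Eij.
    rewrite /= same_block_truncate h //=; apply/negPn/negP => Ki.
    have /andP[/eqP tij _] := h i j Eij.
    apply: NN; have [ij|ji|/val_inj ij] := ltngtP i j.
    - by exists i, j; split=> //; rewrite /bad -tij eqxx ltnNge Ki.
    - by exists j, i; split=> //; rewrite /bad -tij eqxx ltnNge Ki.
    - by move: Eij; rewrite ij /E adj_irr.
  rewrite add0r /bads (bigD1 i) //= (bigD1 j) //= bad_ij -addrA lerDl.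
  by rewrite addr_ge0 // !sumr_ge0 // => *; rewrite sumr_ge0.
have Jbad (i j : 'I_k) : (i < j)%N ->
    (J (fun t => (bad (tnth t i) (tnth t j))%:E) <= (s K)%:E)%E.
  move=> ij.
  rewrite /J (label_integral_coord2 _ _ (fun a b => (bad a b)%:E)) //.
  rewrite -[leRHS](integral_prob_cst (mpc_mu c)); apply: ge0_le_integral => //.
  - by move=> x _; apply: integral_ge0 => y _; rewrite lee_fin.
  - exact: (measurable_fun_label Jmeas
      (fun a => \int[mpc_mu c]_y (bad a (block_label y))%:E)%E).
  move=> x _; have [Kx|xK] := ltnP K (block_label x); last first.
    rewrite integral0_eq; first by rewrite lee_fin mp_ge0.
    by move=> y _; rewrite /bad ltnNge xK andbF.
  apply: le_trans (mass_block_le Kx).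
  rewrite -[X in mpc_mu c X]setIT -integral_indic //.
  apply: ge0_le_integral => //.
  - by move=> y _; rewrite lee_fin.
  - exact: (measurable_fun_label Jmeas (fun b => (bad (block_label x) b)%:E)).
  - by apply/measurable_EFinP; apply: measurable_indic.
  move=> y _; rewrite lee_fin /bad indicE; case: eqP => [xy|//].
  by rewrite Kx mem_set.
have JGle : (J G <= (block_density E K s + (k ^ 2)%:R * s K)%:E)%E.
  apply: (@le_trans _ _ (J (fun t => HK t + (bads t)%:E)%E)).
    by apply: le_label_integral => // t; rewrite lee_fin.
  rewrite /J label_integralD //; last by move=> t; rewrite lee_fin.
  rewrite -/(J HK) JHK EFinD leeD2l //.
  under eq_label_integral => t.
    rewrite /bads -sumEFin.
    under eq_bigr do rewrite -sumEFin; over.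
  rewrite label_integral_sum // => [|i t]; last first.
    by apply: sume_ge0 => j _; rewrite lee_fin.
  apply: (@le_trans _ _ (\sum_(i < k) \sum_(j < k) (s K)%:E)%E).
    apply: lee_sum => i _.
    rewrite label_integral_sum // => [|j t]; last by rewrite lee_fin.
    rewrite big_mkcond; apply: lee_sum => j _.
    by case: ifP => [ij|_]; [exact: Jbad|rewrite lee_fin mp_ge0].
  rewrite (eq_bigr (fun=> (\sum_(j < k) s K)%:E)); last first.
    by move=> i _; rewrite sumEFin.
  rewrite sumEFin lee_fin !sumr_const card_ord.
  by rewrite -mulrnA -[leLHS]mulr_natl mulnn.
have JGge : ((block_density E K s)%:E <= J G)%E.
  by rewrite -JHK; apply: le_label_integral => // t; rewrite lee_fin.
have JGfin : J G \is a fin_num.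
  rewrite ge0_fin_numE; last by apply: label_integral_ge0 => t; rewrite lee_fin.
  exact: le_lt_trans JGle (ltry _).
move: JGle JGge; rewrite JG -{1 2}(fineK JGfin) !lee_fin => h1 h2.
by rewrite ger0_norm ?subr_ge0 // lerBlDl.
Qed.

End MassPartitionDensity.

(** * Disjoint clique graphs *)

Lemma inj_surj_bij (T U : finType) (f : T -> U) :
  injective f -> (forall y, exists x, f x = y) -> bijective f.
Proof.
move=> finj fsurj; exists (fun y => projT1 (cid (fsurj y))) => [x|y].
  by apply: finj; case: cid.
by case: cid.
Qed.

Lemma dunion_completeE (I : finType) (V : I -> finType) (x y : {i : I & V i}) :
  dunion (fun i => complete (V i)) x y = (x != y) && (tag x == tag y).
Proof.
case: x y => i x [j y]; rewrite /= /dunion_adj /=.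
case: eqP => /= [ij|_]; last by rewrite andbF.
by subst j; rewrite tagged_asE andbT eq_Tagged.
Qed.

(** Adjacency by equality of labels gives one clique for each label attained. *)
Lemma DC_of_label (u : ugraph) (V T : finType) (lam : V -> T) (G : sgraph V) :
  (forall x y, G x y = (x != y) && (lam x == lam y)) ->
  iso (repr u : graph) G -> DC u.
Proof.
move=> GE uG; pose A : {set T} := [set lam x | x : V]%SET.
pose B (i : 'I_#|A|) : {set V} := [set x | lam x == enum_val i]%SET.
exists #|A|, (fun i => #|B i|); split.
  move=> i; have /imsetP[x _ ix] := enum_valP i.
  by apply/card_gt0P; exists x; rewrite inE ix.
apply: (iso_trans uG); apply: iso_sym.
pose f (z : {i : 'I_#|A| & 'I_#|B i|}) : V := enum_val (tagged z).
have fB z : lam (f z) = enum_val (tag z).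
  by have := enum_valP (tagged z); rewrite inE => /eqP.
have f_inj : injective f.
  move=> [i x] [j y] fxy.
  have ij : i = j.
    by apply: enum_val_inj; have := fB (Tagged _ y); rewrite -fxy fB.
  by subst j; congr (Tagged _ _); exact: enum_val_inj.
exists f.
  apply: inj_surj_bij => // x.
  have xA : lam x \in A by apply/imsetP; exists x.
  pose i := enum_rank_in xA (lam x).
  have xB : x \in B i by rewrite inE enum_rankK_in.
  exists (Tagged (fun i => 'I_#|B i|) (enum_rank_in xB x)).
  by rewrite /f /= enum_rankK_in.
move=> x y; rewrite GE dunion_completeE (inj_eq f_inj) !fB.
by rewrite (inj_eq enum_val_inj).
Qed.

Lemma card_tag_fiber (I : finType) (V : I -> finType) (i : I) :
  #|[pred z : {i : I & V i} | tag z == i]| = #|V i|.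
Proof.
transitivity (\sum_(i' | i' == i) \sum_(j : V i') 1)%N.
  by rewrite sig_big_dep -sum1_card; apply: eq_bigl => z; rewrite inE andbT.
by rewrite big_pred1_eq sum1_card.
Qed.

Lemma sum_card_fibers (T : finType) (f : T -> nat) n :
  (\sum_(i < n) #|[pred x | f x == i]| <= #|T|)%N.
Proof.
under eq_bigr do rewrite -sum1_card big_mkcond.
rewrite exchange_big -[leqRHS]sum1_card /=; apply: leq_sum => x _.
under eq_bigr do rewrite inE.
rewrite -big_mkcond sum1_card; apply/card_le1_eqP => i j /eqP xi /eqP xj.
by apply/val_inj; rewrite /= -xi -xj.
Qed.

Section BlockGraphs.
Variable R : realType.

(** The weight of label 0 is forced by the total mass. *)
Lemma block_weight_unique K (p : 'I_K.+1 -> R) (s : nat -> R) :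
  \sum_c p c = 1 -> (forall i : 'I_K, p (lift ord0 i) = s i) ->
  p =1 block_weight s.
Proof.
rewrite big_ord_recl => /(canRL (addrK _)) p0 ps c.
case: (unliftP ord0 c) => [i ->|->]; first by rewrite ps.
by rewrite p0; congr (1 - _); apply: eq_bigr => i _; rewrite ps.
Qed.

Lemma uniform_sum1 (V : finType) :
  (0 < #|V|)%N -> \sum_(x : V) #|V|%:R^-1 = 1 :> R.
Proof.
move=> V0; rewrite sumr_const -(mulr_natl (_^-1)).
by rewrite mulfV // pnatr_eq0 -lt0n.
Qed.

(** Loops are seen only by maps that identify the two ends of an edge, which
    has probability [1 / #|V|] for each edge. *)
Lemma wdens_loops k (E : rel 'I_k) (V : finType) (A B : rel V) :
  irreflexive E -> (0 < #|V|)%N -> (forall x y, x != y -> A x y = B x y) ->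
  `|wdens E A (fun=> #|V|%:R^-1) - wdens E B (fun=> #|V|%:R^-1)| <=
  (k ^ 2)%:R * #|V|%:R^-1 :> R.
Proof.
move=> Eirr V0 AB.
apply: le_trans (wdens_close _ (uniform_sum1 V0) _ _ Eirr) _ => //.
apply: ler_wpM2l => //.
rewrite -[leRHS]mulr1 -[X in _ <= _ * X](uniform_sum1 V0) mulr_sumr.
apply: ler_sum => x _.
rewrite (bigD1 x) //= [X in _ + X]big1 => [|y yx].
  by rewrite addr0 ler_piMl ?mulr_ge0 // lern1 leq_b1.
by rewrite AB 1?eq_sym // eqxx mul0r.
Qed.

(** A disjoint clique graph with its cliques labelled from 1, and label 0 kept
    for isolated vertices, has the densities of the step graphon of its
    normalized clique sizes, up to loops. *)
Lemma hom_density_block (F u : ugraph) (V : finType) (G : sgraph V) (K : nat)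
    (lam : V -> 'I_K.+1) (s : nat -> R) :
  iso (repr u : graph) G ->
  (forall x y, G x y = (x != y) && same_block (lam x) (lam y)) ->
  (forall i : 'I_K, #|[pred x | lam x == lift ord0 i]|%:R / #|V|%:R = s i) ->
  `|hom_density R F u - block_density (repr F : graph) K s| <=
  (nverts (repr F) ^ 2)%:R * (nverts (repr u))%:R^-1.
Proof.
move=> uG GE ls; have cV : nverts (repr u) = #|V|.
  by rewrite -(iso_card uG) card_ord.
have V0 : (0 < #|V|)%N by rewrite -cV.
rewrite (hom_density_iso R F uG) cV.
have -> : block_density (repr F : graph) K s = wdens (repr F : graph)
    (relpre lam (relpre val same_block)) (fun=> #|V|%:R^-1).
  rewrite wdens_relpre; apply: eq_wdens => // c; apply/esym; move: c.
  apply: block_weight_unique => [|i].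
    by rewrite -[RHS](uniform_sum1 V0) [RHS](partition_big lam xpredT).
  rewrite -ls sumr_const -[LHS]mulr_natl; congr (_%:R * _).
apply: wdens_loops => //; first by move=> i; rewrite adj_irr.
by move=> x y xy; rewrite GE xy.
Qed.

(** Mass partitions as a subset of a product space, where compactness makes
    sense. *)
Definition mp_set : set {ptws nat -> R} :=
  [set s | [/\ forall i j, (i <= j)%N -> s j <= s i, forall i, 0 <= s i &
    forall n, \sum_(i < n) s i <= 1]].

Lemma mp_setP (s : nat -> R) :
  mp_set s <-> exists m : mass_partition R, mp_seq m = s.
Proof.
split=> [[ni ge0 sum1]|[m <-]].
  have sum1' : (\sum_(i <oo) (s i)%:E <= 1)%E.
    apply: lime_le; first by apply: is_cvg_nneseries => n _ _; rewrite lee_fin.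
    by apply: nearW => n; rewrite big_mkord sumEFin lee_fin.
  by exists (MassPartition ni ge0 sum1').
split; [exact: mp_noninc|exact: mp_ge0|].
move=> n; rewrite -lee_fin; apply: le_trans (@mp_sum_le1 _ m).
rewrite -sumEFin -(big_mkord xpredT (fun i => (m i)%:E)).
by apply: nneseries_lim_ge => i _ _; rewrite lee_fin mp_ge0.
Qed.

(** The first [K + 1] terms are at least [s K] and have sum at most 1. *)
Lemma mp_set_harmonic (s : nat -> R) K : mp_set s -> s K <= K.+1%:R^-1.
Proof.
move=> [ni ge0 /(_ K.+1) sum1]; rewrite -[leRHS]mul1r ler_pdivlMr //.
apply: le_trans sum1; rewrite mulr_natr -[in leLHS](card_ord K.+1) -sumr_const.
by apply: ler_sum => i _; apply: ni; rewrite -ltnS.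
Qed.

(** The mass partition consists of the clique sizes in decreasing order,
    divided by the order of the graph. *)
Lemma DC_near_block (u : ugraph) : DC u ->
  exists K (s : nat -> R), [/\ mp_set s, s K = 0 & forall F,
    `|hom_density R F u - block_density (repr F : graph) K s| <=
    (nverts (repr F) ^ 2)%:R * (nverts (repr u))%:R^-1].
Proof.
move=> [k [m [m0 uG]]]; pose V : finType := {i : 'I_k & 'I_(m i)}.
pose ge_m : rel 'I_k := fun i j => (m j <= m i)%N.
pose r := sort ge_m (enum 'I_k).
have size_r : size r = k by rewrite size_sort size_enum_ord.
have r_uniq : uniq r by rewrite sort_uniq enum_uniq.
have mem_r i : i \in r by rewrite mem_sort mem_enum.
have ge_m_trans : transitive ge_m by move=> i j l ij jl; exact: leq_trans jl ij.
have r_sorted : sorted ge_m r.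
  by apply: sort_sorted => i j; exact: leq_total.
pose rk (x : V) := index (tag x) r.
have rk_lt x : (rk x < k)%N by rewrite -size_r index_mem.
pose lam (x : V) : 'I_k.+1 := inord (rk x).+1.
have lamE x : lam x = (rk x).+1 :> nat by rewrite inordK // ltnS rk_lt.
pose l := [seq m i | i <- r].
have size_l : size l = k by rewrite size_map.
pose cnt i := #|[pred x | rk x == i]|.
have cntE i : cnt i = nth 0%N l i.
  have [ik|ki] := ltnP i k; last first.
    rewrite nth_default ?size_l //; apply: eq_card0 => x.
    rewrite !inE; apply/negbTE.
    by rewrite neq_ltn (leq_trans (rk_lt x)).
  have i0 : 'I_k := Ordinal ik.
  rewrite (nth_map i0) ?size_r // -[RHS]card_ord.
  rewrite -(card_tag_fiber (fun j : 'I_k => 'I_(m j) : finType) (nth i0 r i)).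
  apply: eq_card => x; rewrite !inE -{1}(nth_index i0 (mem_r (tag x))).
  by rewrite nth_uniq ?index_mem ?size_r.
pose s i : R := (cnt i)%:R / #|V|%:R.
have V0 : (0 < #|V|)%N by rewrite -(iso_card uG) card_ord.
exists k, s; split.
- split.
  + move=> i j ij; rewrite /s ler_pM2r ?invr_gt0 ?ltr0n // ler_nat !cntE.
    have [jk|kj] := ltnP j k; last by rewrite [nth _ _ j]nth_default // size_l.
    have l_sorted : sorted geq l by rewrite sorted_map.
    have geq_trans : transitive geq.
      by move=> a b c ab bc; exact: leq_trans bc ab.
    apply: (sorted_leq_nth geq_trans (fun=> leqnn _) 0%N l_sorted i j _ _ ij).
      by rewrite inE size_l (leq_ltn_trans ij).
    by rewrite inE size_l.
  + by move=> i; rewrite divr_ge0.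
  + move=> n; rewrite -mulr_suml ler_pdivrMr ?ltr0n // mul1r -natr_sum ler_nat.
    exact: sum_card_fibers.
- by rewrite /s cntE nth_default ?mul0r // size_l.
move=> F; apply: (hom_density_block F uG (lam := lam)) => [x y|i]; last first.
  congr (_%:R / _); apply: eq_card => x; rewrite !inE.
  by rewrite -val_eqE /= lamE eqSS.
rewrite dunion_completeE /same_block; congr (_ && _).
rewrite !lamE andbT eqSS; apply/eqP/eqP => [txy|rxy].
  by rewrite /rk txy.
by rewrite -(nth_index (tag x) (mem_r (tag x))) -/(rk x) rxy nth_index.
Qed.

(** Conversely a finite list of masses is approximated by the clique sizes
    obtained from rounding down [s i * N.+1]; the vertices left over are
    isolated. *)
Lemma block_graph (K : nat) (s : nat -> R) (N : nat) : mp_set s ->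
  exists2 u : ugraph, DC u /\ nverts (repr u) = N.+1 &
  exists2 q : nat -> R,
    forall i, `|s i - q i| <= N.+1%:R^-1 &
    forall F, `|hom_density R F u - block_density (repr F : graph) K q| <=
      (nverts (repr F) ^ 2)%:R * N.+1%:R^-1.
Proof.
move=> [s_ni s_ge0 s_sum1].
pose tr i := Num.truncn (s i * N.+1%:R).
have N0 : 0 < N.+1%:R :> R by rewrite ltr0n.
have tr_itv i : (tr i)%:R <= s i * N.+1%:R < (tr i).+1%:R.
  by apply: truncn_itv; rewrite mulr_ge0.
have tr_sum : (\sum_(i < K) tr i <= N.+1)%N.
  rewrite -(ler_nat R) natr_sum.
  apply: (@le_trans _ _ (\sum_(i < K) s i * N.+1%:R)).
    by apply: ler_sum => i _; case/andP: (tr_itv i).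
  by rewrite -mulr_suml ger_pMl.
pose m (c : 'I_K.+1) : nat :=
  if (c : nat) is i.+1 then tr i else (N.+1 - \sum_(i < K) tr i)%N.
pose V : finType := {c : 'I_K.+1 & 'I_(m c)}.
pose lam (x : V) : 'I_K.+1 := tag x.
have cV : #|V| = N.+1.
  rewrite card_tagged sumnE big_map big_enum /= big_ord_recl card_ord /=.
  rewrite (eq_bigr (fun i : 'I_K => tr i)) ?subnK // => i _.
  by rewrite card_ord.
pose adjV : rel V := fun x y => (x != y) && same_block (lam x) (lam y).
have adjV_sym : symmetric adjV.
  move=> x y; rewrite /adjV /same_block [y == x]eq_sym.
  rewrite [(_ == lam x :> nat)]eq_sym.
  by congr (_ && _); case: eqP => // ->.
have adjV_irr : irreflexive adjV by move=> x; rewrite /adjV eqxx.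
pose G := SGraph adjV_sym adjV_irr.
have [|u uG] := @iso_ugraph V G; first by rewrite cV.
have cu : nverts (repr u) = N.+1 by rewrite -cV -(iso_card uG) card_ord.
exists u.
  split=> //.
  (* A vertex with label 0 is its own clique. *)
  pose lam' (x : V) : ('I_K.+1 * option V)%type :=
    (lam x, if lam x == ord0 then Some x else None).
  apply: (@DC_of_label u V _ lam' G) => // x y /=.
  rewrite /adjV; case: (eqVneq x y) => //= xy.
  apply/andP/eqP => [[/eqP/val_inj lxy x0]|[lxy oxy]].
    have /negPf l0 : lam x != ord0 by rewrite -val_eqE.
    by rewrite /lam' -lxy l0.
  rewrite lxy; split=> //; apply/negP => /eqP y0; move: oxy.
  have /eqP y00 : lam y = ord0 by exact: val_inj.
  by rewrite lxy y00 => -[exy]; move: xy; rewrite exy eqxx.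
exists (fun i => (tr i)%:R / N.+1%:R).
  move=> i; have /andP[tr1 tr2] := tr_itv i.
  rewrite -{1}[s i](mulfK (lt0r_neq0 N0)) -mulrBl normrM ger0_norm ?subr_ge0 //.
  rewrite ger0_norm ?invr_ge0 // ler_piMl ?invr_ge0 //.
  by rewrite lerBlDl natr1 ltW.
move=> F; rewrite -[in leRHS]cu.
apply: (hom_density_block F uG (lam := lam)) => // i.
rewrite (eq_card (B := [pred x : V | tag x == lift ord0 i])) //.
by rewrite card_tag_fiber card_ord cV.
Qed.

End BlockGraphs.

(** * Limits of disjoint clique graphs *)

Section MassPartitionLimits.
Variable R : realType.

(** The density of [F] in the graphon of a mass partition, defined from the
    masses alone: it is visibly independent of the chosen sets, and makes sense
    on a product space. *)
Definition mp_density (F : ugraph) (s : nat -> R) : R :=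
  limn (fun K => block_density (repr F : graph) K s).

Definition mp_point (s : nat -> R) : ambient R := (fun F => mp_density F s, 0).

Lemma cvg_mul_harmonic (n : nat) :
  n%:R * K.+1%:R^-1 @[K --> \oo] --> (0 : R).
Proof.
rewrite -[X in _ --> X](mulr0 n%:R); apply: cvgM; first exact: cvg_cst.
exact: cvg_harmonic.
Qed.

(** By the truncation bound, as [s K <= 1 / (K + 1)]. *)
Lemma graphon_density_mp (m : mass_partition R) (c : mp_choice m) (F : ugraph) :
  graphon_density (mpc_mu c) F (mp_graphon c) = mp_density F m.
Proof.
have mM : mp_set (m : nat -> R) by apply/mp_setP; exists m.
apply/esym/cvg_lim => //; apply/cvgrPdist_le => e e0.
have /cvgrPdist_le/(_ e e0) := cvg_mul_harmonic (nverts (repr F) ^ 2).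
apply: filterS => K; rewrite sub0r normrN => hK.
apply: le_trans (graphon_density_block c F K) (le_trans _ hK).
rewrite ger0_norm ?mulr_ge0 // ?invr_ge0 //.
by apply: ler_wpM2l => //; exact: mp_set_harmonic.
Qed.

Lemma mp_density_block (s : nat -> R) (F : ugraph) K : mp_set s ->
  `|mp_density F s - block_density (repr F : graph) K s| <=
  (nverts (repr F) ^ 2)%:R * s K.
Proof.
move=> /mp_setP[m <-]; rewrite -(graphon_density_mp (interval_choice m)).
exact: graphon_density_block.
Qed.

Lemma mp_density_harmonic (s : nat -> R) (F : ugraph) K : mp_set s ->
  `|mp_density F s - block_density (repr F : graph) K s| <=
  (nverts (repr F) ^ 2)%:R * K.+1%:R^-1.
Proof.
move=> sM; apply: le_trans (mp_density_block F K sM) _.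
by apply: ler_wpM2l => //; exact: mp_set_harmonic.
Qed.

Lemma cvg_sumr {T : Type} (FF : set_system T) (I : finType) (f : I -> T -> R)
    (l : I -> R) : Filter FF -> (forall i, f i x @[x --> FF] --> l i) ->
  \sum_i f i x @[x --> FF] --> \sum_i l i.
Proof.
by move=> FFF fl; apply: cvg_big => [|i _]; [exact: add_continuous|exact: fl].
Qed.

(** Polynomials are continuous; the filter is arbitrary because the lemma
    serves both for neighbourhoods of mass partitions and for sequences of
    clique sizes. *)
Lemma cvg_block_density {T : Type} (FF : set_system T) (k : nat) (E : rel 'I_k)
    (K : nat) (q : T -> nat -> R) (s : nat -> R) : Filter FF ->
  (forall i, q x i @[x --> FF] --> s i) ->
  block_density E K (q x) @[x --> FF] --> block_density E K s.
Proof.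
move=> FFF qs.
have wt c : @block_weight R K (q x) c @[x --> FF] --> block_weight s c.
  rewrite /block_weight; case: (nat_of_ord c) => [|i]; last exact: qs.
  apply: cvgB; first exact: cvg_cst.
  by apply: cvg_sumr => i; exact: qs.
apply: cvg_sumr => f.
apply: cvgM; first exact: cvg_cst.
by apply: cvg_big => [|v _]; [exact: mul_continuous|exact: wt].
Qed.

(** A closed subset of a cube, compact by the Tychonoff theorem. *)
Lemma mp_set_compact : compact (@mp_set R).
Proof.
apply: (@subclosed_compact _ _
  [set s : {ptws nat -> R} | forall i, `[0, 1]%classic (s i)]).
- have proj_cont i : continuous (fun s : {ptws nat -> R} => s i).
    exact: (@proj_continuous nat (fun=> R : topologicalType) i).
  have closed_ge_comp (f : {ptws nat -> R} -> R) a :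
      continuous f -> closed [set s | a <= f s].
    move=> f_cont; apply: (@preimage_closed _ _ f [set x | a <= x]).
      by move=> s _; exact: f_cont.
    exact: closed_ge.
  have -> : @mp_set R =
      (\bigcap_(ij in [set ij : nat * nat | (ij.1 <= ij.2)%N])
        [set s : {ptws nat -> R} | 0 <= s ij.1 - s ij.2]) `&`
      ((\bigcap_i [set s : {ptws nat -> R} | 0 <= s i]) `&`
       (\bigcap_n [set s : {ptws nat -> R} | -1 <= - \sum_(i < n) s i])).
    apply/seteqP; split=> [s [h1 h2 h3]|s [h1 [h2 h3]]].
      split=> [[i j] /= ij|]; first by rewrite subr_ge0 h1.
      by split=> i _ /=; [exact: h2|rewrite lerN2; exact: h3].
    split=> [i j ij|i|n]; last by have := h3 n Logic.I; rewrite /= lerN2.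
      by have := h1 (i, j) ij; rewrite /= subr_ge0.
    exact: h2.
  apply: closedI; last apply: closedI; apply: closed_bigI => i _.
  + apply: (closed_ge_comp (fun s => s i.1 - s i.2) 0) => s.
    exact: (cvgB (proj_cont i.1 s) (proj_cont i.2 s)).
  + exact: (closed_ge_comp (fun s => s i) 0).
  + apply: (closed_ge_comp (fun s => - \sum_(j < i) s j) (-1)) => s.
    exact: (cvgN (cvg_sumr (nbhs_filter s) (fun j : 'I_i => proj_cont j s))).
- exact: (@tychonoff nat (fun=> R : topologicalType) (fun=> `[0, 1]%classic)
    (fun=> @segment_compact R 0 1)).
- move=> s [ni ge0 sum1] i; rewrite /= in_itv /= ge0 /=.
  apply: le_trans (ni 0%N i _) _ => //.
  by have := sum1 1%N; rewrite big_ord1.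
Qed.

(** A uniform limit of continuous functions: the error of truncation after [K]
    blocks is at most [nverts F ^ 2 / (K + 1)], for all mass partitions. *)
Lemma mp_point_continuous : {within @mp_set R, continuous mp_point}.
Proof.
apply/subspace_continuousP => s sM.
apply: cvg_ambient => [F|]; last exact: cvg_cst.
apply/cvgrPdist_lt => e e0.
have e3 : 0 < e / 3 by rewrite divr_gt0.
(* One [K] serves both for [s] and for all mass partitions near it. *)
have /cvgrPdist_lt/(_ _ e3)[K _ hK] := cvg_mul_harmonic (nverts (repr F) ^ 2).
have {hK} := hK K (leqnn K); rewrite /= sub0r normrN => hK.
have close t : mp_set t ->
    `|mp_density F t - block_density (repr F : graph) K t| < e / 3.
  move=> tM; apply: le_lt_trans (mp_density_harmonic F K tM) _.
  exact: le_lt_trans (ler_norm _) hK.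
have near_s : nbhs (s : {ptws nat -> R}) [set t |
    `|block_density (repr F : graph) K s -
      block_density (repr F : graph) K t| < e / 3].
  have cvg_s := @cvg_block_density _ (nbhs (s : {ptws nat -> R})) _
    (repr F : graph) K (fun t => t) s (nbhs_filter (s : {ptws nat -> R}))
    (fun i => @proj_continuous nat (fun=> R : topologicalType) i s).
  by move/cvgrPdist_lt : cvg_s => /(_ _ e3).
change (nbhs (s : {ptws nat -> R})
  [set t | mp_set t -> `|mp_density F s - mp_density F t| < e]).
apply: (@filterS _ _ (nbhs_filter (s : {ptws nat -> R})) _ _ _ near_s).
move=> t /= st tM.
have h1 := close s sM; have h2 := close t tM.
apply: le_lt_trans (ler_distD (block_density (repr F : graph) K s) _ _) _.
apply: le_lt_trans (lerD (lexx _)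
  (ler_distD (block_density (repr F : graph) K t) _ _)) _.
rewrite [X in _ + (_ + X)]distrC; lra.
Qed.

Lemma mp_points_closed : closed [set mp_point s | s in @mp_set R].
Proof.
apply: compact_closed; first exact: ambient_hausdorff.
exact: continuous_compact mp_point_continuous mp_set_compact.
Qed.

(** Two successive limits: clique sizes rounded at scale [N + 1] converge to
    the truncation at [K] as [N] grows, and the truncations converge as [K]
    grows. *)
Lemma mp_point_closure s : mp_set s -> closure (embed R @` DC) (mp_point s).
Proof.
move=> sM.
have trunc K : closure (embed R @` DC)
    ((fun F => block_density (repr F : graph) K s, 0) : ambient R).
  have hN N := block_graph K N sM.
  pose u N := projT1 (cid2 (hN N)).
  have uDC N : DC (u N) by rewrite /u; case: cid2 => ? [].
  have uN N : nverts (repr (u N)) = N.+1 by rewrite /u; case: cid2 => ? [].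
  have hq N : exists2 q : nat -> R, forall i, `|s i - q i| <= N.+1%:R^-1 &
      forall F, `|hom_density R F (u N) - block_density (repr F : graph) K q| <=
      (nverts (repr F) ^ 2)%:R * N.+1%:R^-1 by rewrite /u; case: cid2.
  pose q N := projT1 (cid2 (hq N)).
  have q1 N i : `|s i - q N i| <= N.+1%:R^-1 by rewrite /q; case: cid2.
  have q2 N F :
      `|hom_density R F (u N) - block_density (repr F : graph) K (q N)| <=
      (nverts (repr F) ^ 2)%:R * N.+1%:R^-1 by rewrite /q; case: cid2.
  have qs i : q N i @[N --> \oo] --> s i.
    apply/cvgrPdist_le => e e0.
    have /cvgrPdist_le/(_ e e0) := @cvg_harmonic R.
    apply: filterS => N; rewrite sub0r normrN ger0_norm ?invr_ge0 // => hN'.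
    exact: le_trans (q1 N i) hN'.
  apply: (@closed_cvg _ _ \oo _ (fun N => embed R (u N))).
  - exact: closed_closure.
  - by apply: nearW => N; apply: subset_closure; exists (u N).
  apply: cvg_ambient => [F|] /=; last first.
    by under eq_cvg do rewrite uN; exact: cvg_harmonic.
  have -> : hom_density R F (u x) @[x --> \oo] = 
    (hom_density R F (u x) - block_density (repr F : graph) K (q x)
       + block_density (repr F : graph) K (q x)) @[x --> \oo].
    by under [in RHS]eq_fun do rewrite subrK.
  rewrite -[X in _ --> X]add0r; apply: cvgD; last exact: cvg_block_density.
  apply/cvgr0Pnorm_le => e e0.
  have /cvgrPdist_le/(_ e e0) := cvg_mul_harmonic (nverts (repr F) ^ 2).
  apply: filterS => N; rewrite sub0r normrN ger0_norm ?mulr_ge0 ?invr_ge0 //.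
  exact: le_trans.
apply: (@closed_cvg _ _ \oo _ (fun K =>
  ((fun F => block_density (repr F : graph) K s, 0) : ambient R))).
- exact: closed_closure.
- exact: nearW.
apply: cvg_ambient => [F|] /=; last exact: cvg_cst.
apply/cvgrPdist_le => e e0.
have /cvgrPdist_le/(_ e e0) := cvg_mul_harmonic (nverts (repr F) ^ 2).
apply: filterS => K; rewrite sub0r normrN => hK.
apply: le_trans (mp_density_harmonic F K sM) _.
exact: le_trans (ler_norm _) hK.
Qed.

Lemma closure_embedS (P Q : set ugraph) Gamma :
  P `<=` Q -> closure (embed R @` P) Gamma -> closure (embed R @` Q) Gamma.
Proof. by move=> PQ; apply: closureS; exact: image_subset. Qed.

Lemma hatE (P : set ugraph) :
  hat R P = closure (embed R @` P) `&` [set Gamma | Gamma.2 = 0].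
Proof.
apply/seteqP; split=> Gamma [cG G2]; split=> //;
  by apply/(UhatP (closure_embedS (@subsetT _ P) cG)).
Qed.

(** A disjoint clique graph lies near the limit point of its normalized clique
    sizes, and these limit points form a closed set. *)
Lemma hat_DC : hat R DC = [set mp_point s | s in @mp_set R].
Proof.
rewrite hatE; apply/seteqP; split=> [Gamma [cG G0]|_ [s sM <-]]; last first.
  by split=> //; exact: mp_point_closure.
apply: mp_points_closed.
apply: (closure_approx (C := fun F => (nverts (repr F) ^ 2)%N)) cG => // e e0.
exists e => // _ [u uDC <-] /= ue.
have [K [s [sM sK hs]]] := DC_near_block R uDC.
exists (mp_point s); first by exists s.
have {}ue : (nverts (repr u))%:R^-1 <= e.
  by rewrite ltW // (le_lt_trans _ ue) // ler_norm.
split; first by rewrite subr0 ger0_norm ?invr_ge0.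
move=> F /=.
have := mp_density_block F K sM; rewrite sK mulr0 normr_le0 subr_eq0 => /eqP ->.
by apply: le_trans (hs F) _; apply: ler_wpM2l.
Qed.

Lemma mp_limitE (m : mass_partition R) (c : mp_choice m) :
  mp_limit c = mp_point m.
Proof.
have mM : mp_set (m : nat -> R) by apply/mp_setP; exists m.
have pointU : Uhat (mp_point m).
  have : hat R DC (mp_point m) by rewrite hat_DC; exists (m : nat -> R).
  by case.
have : [set Gamma | represents (mpc_mu c) (mp_graphon c) Gamma] (mp_limit c).
  apply: (@getPex _ [set Gamma | represents (mpc_mu c) (mp_graphon c) Gamma]).
  by exists (mp_point m); split=> // F; rewrite graphon_density_mp.
move=> [[limU1 limU2] limd]; have lim0 : (mp_limit c).2 = 0.
  by apply/(UhatP limU1).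
rewrite [LHS]surjective_pairing lim0; congr pair; apply/funext => F.
by rewrite -[LHS]/(lim_density F _) limd graphon_density_mp.
Qed.

Lemma hat_DC_mp_limit (c : forall s : mass_partition R, mp_choice s) :
  hat R DC = [set mp_limit (c s) | s in [set: mass_partition R]].
Proof.
rewrite hat_DC; apply/seteqP; split=> [_ [s /mp_setP[m <-] <-]|_ [m _ <-]].
  by exists m => //; rewrite mp_limitE.
by exists (m : nat -> R); [apply/mp_setP; exists m|rewrite mp_limitE].
Qed.

End MassPartitionLimits.

(** * Line graphs *)

Section LineGraphs.
Variables (V : finType) (G : sgraph V).

Lemma is_edgeP (e : {set V}) :
  reflect (exists x y, G x y /\ e = [set x; y]%SET) (is_edge G e).
Proof.
apply: (iffP existsP) => [[x /existsP[y /andP[xy /eqP ->]]]|[x [y [xy ->]]]].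
  by exists x, y.
by exists x; apply/existsP; exists y; rewrite xy eqxx.
Qed.

Lemma card_edge (e : edge G) : #|val e| = 2.
Proof.
have /is_edgeP[x [y [xy ->]]] := valP e.
by rewrite cards2; case: eqP xy => // ->; rewrite adj_irr.
Qed.

Lemma edge_eq2 (e : edge G) v w :
  v \in val e -> w \in val e -> v != w -> val e = [set v; w]%SET.
Proof.
move=> ve we vw; apply/esym/eqP; rewrite eqEcard card_edge cards2 vw /= andbT.
by apply/fintype.subsetP => z; rewrite !inE => /orP[] /eqP ->.
Qed.

Lemma line_adjP (e f : edge G) :
  reflect (e != f /\ exists2 v, v \in val e & v \in val f) (line_graph G e f).
Proof.
apply: (iffP andP) => -[ef]; rewrite -setI_eq0.
  by move=> /set0Pn[v]; rewrite inE => /andP[ve vf]; split=> //; exists v.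
by move=> [v ve vf]; split=> //; apply/set0Pn; exists v; rewrite inE ve.
Qed.

End LineGraphs.

(** Needed since a line graph is taken of a graph on an ordinal, while the
    star forests below have another vertex type. *)
Lemma iso_line_graph (V W : finType) (G : sgraph V) (H : sgraph W) :
  iso G H -> iso (line_graph G) (line_graph H).
Proof.
move=> [f [g fK gK] fGH]; have f_inj := can_inj fK.
have f_edge (e : edge G) : is_edge H (f @: val e).
  have /is_edgeP[x [y [xy ->]]] := valP e.
  by apply/is_edgeP; exists (f x), (f y); rewrite fGH imsetU !imset_set1.
pose fe (e : edge G) : edge H := Sub (f @: val e) (f_edge e).
have fe_inj : injective fe.
  by move=> e e' /(congr1 val) /= /(imset_inj f_inj)/val_inj.
exists fe.
  apply: inj_surj_bij => // e'.
  have /is_edgeP[x [y [xy e'E]]] := valP e'.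
  have e_edge : is_edge G [set g x; g y]%SET.
    by apply/is_edgeP; exists (g x), (g y); rewrite -fGH !gK.
  exists (Sub [set g x; g y]%SET e_edge); apply: val_inj => /=.
  by rewrite e'E imsetU !imset_set1 !gK.
move=> e e'; apply/line_adjP/line_adjP => -[].
  rewrite (inj_eq fe_inj) => ee' [w /imsetP[x xe ->]].
  by rewrite mem_imset // => xe'; split=> //; exists x.
move=> ee' [x xe xe']; split; first by rewrite (inj_eq fe_inj).
by exists (f x); rewrite mem_imset.
Qed.

(** A clique is the line graph of a star, so a disjoint union of cliques is the
    line graph of a forest of stars. *)
Lemma DC_sub_LG : DC `<=` LG.
Proof.
move=> u [k [m [m0 uG]]]; pose V : finType := {i : 'I_k & 'I_(m i)}.
pose star (x y : 'I_k + V) : bool := match x, y with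
  | inl i, inr v => tag v == i
  | inr v, inl i => tag v == i
  | _, _ => false
  end.
have star_sym : symmetric star by do 2!case=> ?.
have star_irr : irreflexive star by case.
pose S := SGraph star_sym star_irr.
have V0 : (0 < #|V|)%N by rewrite -(iso_card uG) card_ord.
have [|H HS] := @iso_graph _ S; first by rewrite card_sum addn_gt0 V0 orbT.
exists H; apply: (iso_trans uG); apply: iso_trans (iso_sym (iso_line_graph HS)).
have st_edge (v : V) : is_edge S [set inl (tag v); inr v]%SET.
  by apply/is_edgeP; exists (inl (tag v)), (inr v); rewrite /= eqxx.
pose f (v : V) : edge S := Sub [set inl (tag v); inr v]%SET (st_edge v).
have f_inj : injective f.
  move=> v w /(congr1 val) /= vw.
  have : inr v \in [set inl (tag w); inr w : 'I_k + V]%SET.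
    by rewrite -vw !inE eqxx orbT.
  by rewrite !inE /= => /eqP[].
exists f.
  apply: inj_surj_bij => // e; have /is_edgeP[x [y [xy eE]]] := valP e.
  case: x y xy eE => [i|v] [j|w] //= /eqP tv eE.
    by exists w; apply: val_inj; rewrite /= eE tv.
  by exists v; apply: val_inj; rewrite /= eE tv finset.setUC.
move=> v w; rewrite dunion_completeE; apply/line_adjP/andP.
  rewrite (inj_eq f_inj) => -[vw [x]]; rewrite !inE.
  by move=> /orP[]/eqP-> /orP[]/eqP // -[evw]; rewrite vw evw.
rewrite (inj_eq f_inj) => -[vw /eqP tvw]; split=> //.
by exists (inl (tag v)); rewrite !inE ?eqxx // tvw eqxx.
Qed.

Section LineGraphApproximation.
Variables (V : finType) (G : sgraph V) (q : nat).
Hypothesis q0 : (0 < q)%N.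

Let n := #|{: edge G}|.

Definition star_at (v : V) : {set edge G} := [set e : edge G | v \in val e]%SET.

Definition big_vertex (v : V) : bool := (n < q * #|star_at v|)%N.

(** The cliques of the approximating graph are the stars at the big vertices;
    an edge with no big end stays isolated. *)
Definition edge_label (e : edge G) : V + edge G :=
  if [pick v in val e | big_vertex v] is Some v then inl v else inr e.

(** The edges with two big ends, which lie in two of the stars.  They are few,
    because there are at most [2 * q] big vertices. *)
Definition heavy_edges : {set edge G} :=
  [set e : edge G | val e \subset [set v | big_vertex v]%SET]%SET.

Lemma sum_star : (\sum_v #|star_at v| = 2 * n)%N.
Proof.
under eq_bigr do rewrite -sum1dep_card big_mkcond.
rewrite exchange_big /= -[n]/#|{: edge G}| mulnC -sum_nat_const.
apply: eq_bigr => e _.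
by rewrite -big_mkcond sum1_card card_edge.
Qed.

Lemma card_big_vertex : (#|[set v | big_vertex v]%SET| <= 2 * q)%N.
Proof.
have [n0|n0] := posnP n.
  rewrite (_ : #|_| = 0%N) //; apply: eq_card0 => v; rewrite !inE /big_vertex.
  have star0 : #|star_at v| = 0%N.
    by apply/eqP; rewrite -leqn0 -[leqRHS]n0 max_card.
  by rewrite star0 muln0.
rewrite -(leq_pmul2r n0) -sum_nat_const mulnAC -sum_star big_distrl /=.
rewrite big_mkcond; apply: leq_sum => v _; rewrite inE; case: ifP => // vbig.
by rewrite mulnC; exact: ltnW.
Qed.

Lemma card_heavy_edges : (#|heavy_edges| <= (2 * q) ^ 2)%N.
Proof.
pose B := [set v | big_vertex v]%SET.
apply: (@leq_trans (#|B| ^ 2)); last by rewrite leq_exp2r // card_big_vertex.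
rewrite -(card_imset _ val_inj) -mulnn -cardsX.
apply: leq_trans (leq_imset_card (fun p : V * V => [set p.1; p.2]%SET) _).
apply/subset_leq_card/fintype.subsetP => _ /imsetP[e eH ->].
move: eH; rewrite inE => eB.
have /is_edgeP[x [y [xy eE]]] := valP e.
apply/imsetP; exists (x, y) => //.
by rewrite inE /= !(fintype.subsetP eB) // eE !inE eqxx ?orbT.
Qed.

Lemma edge_label_big (e : edge G) (v : V) :
  v \in val e -> big_vertex v -> e \notin heavy_edges -> edge_label e = inl v.
Proof.
move=> ve vbig; rewrite /edge_label; case: pickP => [w /andP[we wbig]|].
  have [-> //|wv] := eqVneq w v.
  rewrite inE (edge_eq2 we ve wv); case/negP; apply/fintype.subsetP => z.
  by rewrite !inE => /orP[]/eqP ->.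
by move=> /(_ v); rewrite inE /= ve vbig.
Qed.

Lemma edge_label_adj (e f : edge G) :
  e != f -> edge_label e = edge_label f -> line_graph G e f.
Proof.
move=> ef; rewrite /edge_label.
case: pickP => [v /andP[ve _]|_]; case: pickP => [w /andP[wf _]|_] //.
  by move=> [vw]; apply/line_adjP; split=> //; exists v; rewrite // vw.
by move=> [fe]; rewrite fe eqxx in ef.
Qed.

Definition bad_pairs : {set edge G * edge G} :=
  [set p : edge G * edge G | line_graph G p.1 p.2 !=
           (p.1 != p.2) && (edge_label p.1 == edge_label p.2)]%SET.

(** Adjacent edges that are not heavy and meet in a big vertex have the same
    label, so the errors come from heavy edges or from edges that meet in a
    small vertex. *)
Lemma bad_pairs_sub : bad_pairs \subset
  (finset.setX heavy_edges [set: edge G] :|: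
   finset.setX [set: edge G] heavy_edges :|:
   \bigcup_(v | ~~ big_vertex v) finset.setX (star_at v) (star_at v))%SET.
Proof.
apply/fintype.subsetP => -[e f]; rewrite inE => bad0.
have {bad0} bad : line_graph G e f !=
    (e != f) && (edge_label e == edge_label f) := bad0.
rewrite !finset.in_setU !finset.in_setX !finset.in_setT /= andbT.
have [//|eN /=] := boolP (e \in heavy_edges).
have [//|fN /=] := boolP (f \in heavy_edges).
have [ef [v ve vf]] : e != f /\ exists2 v, v \in val e & v \in val f.
  apply/line_adjP; move: bad; case: line_adjP => // N.
  case: andP => [[ef /eqP lef] _|_]; last by rewrite eqxx.
  by case: N; apply/line_adjP; exact: edge_label_adj.
apply/finset.bigcupP; exists v; last by rewrite !inE ve.
apply/negP => vbig; move: bad; rewrite (edge_label_big ve vbig eN).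
rewrite (edge_label_big vf vbig fN) eqxx ef.
have -> : line_graph G e f by apply/line_adjP; split=> //; exists v.
by [].
Qed.

(** The pairs meeting in a small vertex number at most the sum of the squared
    small degrees, each bounded by [n / q] times the degree, and the degrees sum
    to [2 * n]. *)
Lemma card_bad_pairs :
  (q * #|bad_pairs| <= 8 * q ^ 3 * n + 2 * n ^ 2)%N.
Proof.
have := subset_leq_card bad_pairs_sub; rewrite -(leq_pmul2l q0).
move=> /leq_trans; apply.
apply: (@leq_trans (q * (2 * (4 * q ^ 2 * n)
    + \sum_(v | ~~ big_vertex v) #|star_at v| ^ 2)))%N.
  rewrite leq_pmul2l //; apply: leq_trans (leq_card_setU _ _) _.
  apply: leq_add.
    apply: leq_trans (leq_card_setU _ _) _; rewrite !cardsX cardsT -/n.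
    rewrite [(n * _)%N]mulnC addnn -mul2n leq_pmul2l // leq_mul2r.
    by rewrite (leq_trans card_heavy_edges) ?orbT // expnMn.
  apply: (@leq_trans
    (\sum_(v | ~~ big_vertex v) #|finset.setX (star_at v) (star_at v)|)%N).
    elim/big_rec2 : _ => [|v a A _ IH]; first by rewrite cards0.
    by apply: leq_trans (leq_card_setU _ _) _; rewrite leq_add2l.
  by apply: leq_sum => v _; rewrite cardsX mulnn.
rewrite mulnDr; apply: leq_add.
  rewrite (expnS q 2); set a := (q ^ 2)%N; nia.
rewrite big_distrr /= -mulnn mulnA -sum_star big_distrl /= big_mkcond.
apply: leq_sum => v _; case: ifP => // small.
rewrite -mulnn mulnA mulnC leq_mul2l; apply/orP; right.
by rewrite leqNgt.
Qed.

End LineGraphApproximation.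

Section LineGraphLimits.
Variable R : realType.

(** Once the order is at least [8 * q ^ 3] the heavy edges contribute no more
    than [1 / q] to the proportion of wrong pairs, the small vertices at most
    [2 / q]. *)
Lemma LG_near_DC (u : ugraph) (q : nat) : LG u -> (0 < q)%N ->
  (8 * q ^ 3 <= nverts (repr u))%N ->
  exists2 u', DC u' & nverts (repr u') = nverts (repr u) /\
    forall F, `|hom_density R F u - hom_density R F u'| <=
      (nverts (repr F) ^ 2)%:R * (3 / q%:R).
Proof.
move=> [H uG] q0; set n := nverts (repr u) => nq.
have cE : #|{: edge H}| = n by rewrite -(iso_card uG) card_ord.
have n0 : (0 < #|{: edge H}|)%N by rewrite cE.
pose lab := @edge_label _ H q.
pose adjE : rel (edge H) := fun e f => (e != f) && (lab e == lab f).
have adjE_sym : symmetric adjE.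
  by move=> e f; rewrite /adjE eq_sym [lab e == _]eq_sym.
have adjE_irr : irreflexive adjE by move=> e; rewrite /adjE eqxx.
have [u' u'G] := iso_ugraph (SGraph adjE_sym adjE_irr) n0.
exists u'; first exact: (DC_of_label (lam := lab) _ u'G).
split; first by rewrite -[LHS]card_ord (iso_card u'G) cE.
move=> F; rewrite (hom_density_iso R F uG) (hom_density_iso R F u'G).
apply: le_trans (wdens_close _ (uniform_sum1 R n0) _ _
  (@adj_irr _ (repr F : graph))) _.
  by move=> e; rewrite invr_ge0.
apply: ler_wpM2l => //.
rewrite pair_bigA /= -mulr_suml.
have -> : \sum_(p : edge H * edge H) (line_graph H p.1 p.2 != adjE p.1 p.2)%:R =
    #|bad_pairs H q|%:R :> R.
  rewrite -sum1_card natr_sum [RHS]big_mkcond /=; apply: eq_bigr => p _.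
  by rewrite inE; case: ifP.
rewrite cE; have nR : 0 < n%:R :> R by rewrite ltr0n -cE.
have qR : 0 < q%:R :> R by rewrite ltr0n.
rewrite -invfM ler_pdivrMr ?mulr_gt0 // mulrAC ler_pdivlMr // -!natrM ler_nat.
have := @card_bad_pairs _ H q q0; rewrite cE; nia.
Qed.

Lemma hat_LG : hat R LG = hat R DC.
Proof.
rewrite !hatE; apply/seteqP; split=> Gamma [cG G0]; split=> //; last first.
  exact: closure_embedS DC_sub_LG cG.
apply: (closure_approx (C := fun F => (nverts (repr F) ^ 2)%N)) cG => // e e0.
(* The error [3 / q] has to be at most [e]. *)
pose q := (Num.truncn (3 / e)).+1.
have qe : 3 / q%:R <= e.
  rewrite ler_pdivrMr ?ltr0n // mulrC -ler_pdivrMr //.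
  by apply/ltW/truncnS_gt.
exists (8 * q ^ 3)%:R^-1 => [|_ [u uLG <-] /= ue].
  by rewrite invr_gt0 ltr0n muln_gt0 expn_gt0.
have nq : (8 * q ^ 3 <= nverts (repr u))%N.
  rewrite -(ler_nat R) -lef_pV2 ?posrE ?ltr0n ?muln_gt0 ?expn_gt0 //.
  by apply: ltW; rewrite ger0_norm ?invr_ge0 in ue.
have [u' u'DC [nu' hu']] := LG_near_DC uLG (ltn0Sn _) nq.
exists (embed R u'); first by exists u'.
split; first by rewrite /= nu' subrr normr0 ltW.
by move=> F; apply: le_trans (hu' F) _; apply: ler_wpM2l.
Qed.

End LineGraphLimits.

Theorem theorem8p3 (R : realType) :
  hat R LG = hat R DC /\
  (forall c : (forall s : mass_partition R, mp_choice s),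
     hat R LG = [set mp_limit (c s) | s in [set: mass_partition R]]).
Proof. by split=> [|c]; rewrite hat_LG // (hat_DC_mp_limit c). Qed.
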